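(* Consider a martingale $(Y_t)_{t\in\mathbb N}$ with $Y_0=0$ taking values in a separable Banach space $(\mathcal X,\|\cdot\|)$. Let the function $\Psi:\mathcal X\to\mathbb R$ be $(2,D)$-smooth and define $D_\star:=1\vee D$. (a) Suppose $\|\Delta Y_t\|\le c_t$ a.s. for all $t\in\mathbb N$ for some constants $(c_t)_{t\in\mathbb N}$, and let $V_t:=\sum_{i=1}^tc_i^2$. Then for any $x,m>0$, $$\mathbb P\left(\exists t\in\mathbb N:\Psi(Y_t)\ge x+\frac x{2m}(V_t-m)\right)\le2\exp\left\{-\frac{x^2}{2D_\star^2m}\right\}.$$ (b) Suppose $\|\Delta Y_t\|\le c$ a.s. for all $t\in\mathbb N$ for some constant $c>0$, and let $V_t:=\sum_{i=1}^t\mathbb E_{i-1}\|\Delta Y_i\|^2$. Then for any $x,m>0$, $$\mathbb P\left(\exists t\in\mathbb N:\Psi(Y_t)\ge x+D_\star^2\,\mathfrak s_P\left(\frac x{D_\star^2m}\right)(V_t-m)\right)\le2\exp\left\{-D_\star^2m\,\psi_P^\star\left(\frac x{D_\star^2m}\right)\right\}\le2\exp\left\{-\frac{x^2}{2(D_\star^2m+cx/3)}\right\}.$$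
   Context: A function $\Psi:\mathcal X\to\mathbb R$ is $(2,D)$-smooth for some $D>0$ if for all $x,v\in\mathcal X$: $\Psi(0)=0$; $|\Psi(x+v)-\Psi(x)|\le\|v\|$; and $\Psi^2(x+v)-2\Psi^2(x)+\Psi^2(x-v)\le2D^2\|v\|^2$. $\Delta Y_t=Y_t-Y_{t-1}$; $\mathbb E_t=\mathbb E(\cdot\mid\mathcal F_t)$, where $(\mathcal F_t)$ is the filtration of the martingale and $\mathcal F_0$ is trivial. With the constant $c$ of (b), $\psi_P^\star(u)=\frac{(1+cu)\log(1+cu)-cu}{c^2}$ and $\mathfrak s_P(u)=\frac{cu-\log(1+cu)}{c\log(1+cu)}$. *)

(* Defs.v *)
From HB Require Import structures.
From mathcomp Require Import all_boot all_order all_algebra.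
From mathcomp Require Import all_classical all_reals all_analysis.

Set Implicit Arguments.
Unset Strict Implicit.
Unset Printing Implicit Defensive.

Import Order.TTheory GRing.Theory Num.Theory.
Import numFieldNormedType.Exports.

Local Open Scope classical_set_scope.
Local Open Scope ring_scope.

Definition separable (X : topologicalType) : Prop :=
  exists A : set X, countable A /\ dense A.

Definition borel_measurable (T : Type) (X : topologicalType)
    (G : set (set T)) (f : T -> X) : Prop :=
  forall B : set X, <<s open >> B -> G (f @^-1` B).

(* A simple function is given by a finite list of pairs (A, x), read as the sum
   of the functions x 1_A; the sets A may overlap. *)
Definition simple_eval (T : Type) (R : realType) (X : normedModType R)
    (s : seq (set T * X)) (w : T) : X :=
  \sum_(p <- s) (\1_(p.1) w : R) *: p.2.

Definition simple_integral d (T : measurableType d) (R : realType)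
    (P : probability T R) (X : normedModType R) (A : set T)
    (s : seq (set T * X)) : X :=
  \sum_(p <- s) fine (P (A `&` p.1)) *: p.2.

(* v is the Bochner integral of f over A: f is approximated in L^1(A; X) by
   simple functions whose integrals over A converge to v.  Borel measurability
   is the right measurability requirement only for separable X. *)
Definition is_bochner_integral d (T : measurableType d) (R : realType)
    (P : probability T R) (X : normedModType R) (A : set T) (f : T -> X)
    (v : X) : Prop :=
  borel_measurable measurable f /\
  exists s : nat -> seq (set T * X),
    [/\ forall n p, p \in s n -> measurable p.1,
        (fun n => \int[P]_(w in A) (`|f w - simple_eval (s n) w|)%:E)%E
          @ \oo --> 0%E &
        (fun n => simple_integral P A (s n)) @ \oo --> v].

Definition bochner_integrable d (T : measurableType d) (R : realType)
    (P : probability T R) (X : normedModType R) (f : T -> X) : Prop :=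
  exists v : X, is_bochner_integral P setT f v.

(* g is a version of E(f | G), for X-valued f and a sub-sigma-algebra G. *)
Definition is_bochner_cond_exp d (T : measurableType d) (R : realType)
    (P : probability T R) (X : normedModType R) (G : set (set T))
    (f g : T -> X) : Prop :=
  [/\ bochner_integrable P f, bochner_integrable P g, borel_measurable G g &
      forall A, G A -> exists v : X,
        is_bochner_integral P A f v /\ is_bochner_integral P A g v].

(* g is a version of E(f | G), for real-valued f. *)
Definition is_cond_exp d (T : measurableType d) (R : realType)
    (P : probability T R) (G : set (set T)) (f g : T -> R) : Prop :=
  [/\ P.-integrable setT (EFin \o f), P.-integrable setT (EFin \o g),
      borel_measurable G g &
      forall A, G A ->
        (\int[P]_(w in A) (g w)%:E = \int[P]_(w in A) (f w)%:E)%E].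

Definition filtration d (T : measurableType d) (F : nat -> set (set T)) : Prop :=
  [/\ forall t, sigma_algebra setT (F t),
      forall t, F t `<=` measurable &
      forall s t, (s <= t)%N -> F s `<=` F t].

Definition martingale d (T : measurableType d) (R : realType)
    (P : probability T R) (X : normedModType R) (F : nat -> set (set T))
    (Y : nat -> T -> X) : Prop :=
  [/\ forall t, borel_measurable (F t) (Y t),
      forall t, bochner_integrable P (Y t) &
      forall t, is_bochner_cond_exp P (F t) (Y t.+1) (Y t)].

Definition smooth2 (R : realType) (X : normedModType R) (D : R)
    (Psi : X -> R) : Prop :=
  [/\ 0 < D, Psi 0 = 0,
      forall x v : X, `|Psi (x + v) - Psi x| <= `|v| &
      forall x v : X,
        Psi (x + v) ^+ 2 - 2 * Psi x ^+ 2 + Psi (x - v) ^+ 2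
          <= 2 * D ^+ 2 * `|v| ^+ 2].

(* Meaningful for t > 0. *)
Definition increment (T : Type) (R : realType) (X : normedModType R)
    (Y : nat -> T -> X) (t : nat) (w : T) : X :=
  Y t w - Y t.-1 w.

Definition psi_P_star (R : realType) (c u : R) : R :=
  ((1 + c * u) * ln (1 + c * u) - c * u) / c ^+ 2.

Definition s_P (R : realType) (c u : R) : R :=
  (c * u - ln (1 + c * u)) / (c * ln (1 + c * u)).

(* Main.v *)
Require Import Defs.
From HB Require Import structures.
From mathcomp Require Import all_boot all_order all_algebra.
From mathcomp Require Import ring lra.
From mathcomp Require Import all_classical all_reals all_analysis.
From mathcomp Require Import measurable_realfun.

Set Implicit Arguments.
Unset Strict Implicit.
Unset Printing Implicit Defensive.

Import Order.TTheory GRing.Theory Num.Theory.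
Import numFieldNormedType.Exports.

Local Open Scope classical_set_scope.
Local Open Scope ring_scope.

(* Psi^2 has second differences at most 2 D^2 |v|^2, so at each point x it has a
   supergradient: a bounded linear L with |L v| <= 2 |Psi x| |v| and
   Psi (x + v)^2 <= Psi x^2 + L v + D^2 |v|^2; no differentiability of Psi is
   involved. Convexity of s |-> cosh (sqrt s) turns this into a bound on
   cosh (lam Psi (x + v)) that is linear in L v, and integrating it along the
   martingale makes cosh (lam Psi (Y_t)) exp (- W_t) a supermartingale, with
   W_t = lam^2 Dstar^2 V_t / 2 in (a) and
   W_t = Dstar^2 (e^(lam c) - 1 - lam c) V_t / c^2 in (b). Ville's inequality
   and cosh u >= e^u / 2 give the bounds for lam = x / (Dstar^2 m) and
   lam = ln (1 + c x / (Dstar^2 m)) / c respectively. *)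

(** * Estimates for the hyperbolic cosine *)

(** [Psi] has no fixed sign and only its square has controlled second differences, which is why the
    process is built on [cosh]: [cosh (lam Psi)] is a function of [Psi^2]. The factor 2 in the
    bounds is the price. [Dstar] replaces [D] because the Lipschitz constant 1 only limits the
    linear term by [2 |Psi x| |v|]; comparing [cosh] with its secants needs a scale that dominates
    this term too, hence one of at least 1. The supergradient at [Y_t] is a random functional,
    whereas the Bochner martingale property can only be tested against fixed functionals. One step
    is therefore proved on cells where [Y_t] and [W_(t+1)] are nearly constant, with an error factor
    tending to 1; separability makes countably many cells suffice. In both parts [lam] maximises the
    exponent, [lam x - lam^2 Dstar^2 m / 2] or [lam x - Dstar^2 m (e^(lam c) - 1 - lam c) / c^2],
    and for this [lam] the boundary, affine in [V_t], is where [lam Psi (Y_t) - W_t] equals that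
    maximum. *)

Section hyperbolic.
Variable R : realType.
Implicit Types (a b p q x y t u w : R) (s : seq (R * R)).

(** Expanding the exponentials leaves one inequality between power sums per degree. A pair in [s] is
    a weight and a point; suitable lists give the convexity of [cosh (sqrt s)], the lower bound on
    [sinh] and the Taylor remainder estimates below. *)
Lemma expR_comb_tail_ge0 (m : nat) s :
  (forall k, (m <= k)%N -> 0 <= \sum_(i <- s) i.1 * i.2 ^+ k) ->
  0 <= \sum_(i <- s) i.1 * (expR i.2 - series (exp_coeff i.2) m).
Proof.
move=> H.
pose f (n : nat) :=
  \sum_(i <- s) i.1 * (series (exp_coeff i.2) n - series (exp_coeff i.2) m).
have cf : f @ \oo --> \sum_(i <- s) i.1 * (expR i.2 - series (exp_coeff i.2) m).
  rewrite /f; elim: (s) => [|i r IH].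
    by under eq_fun do rewrite big_nil; rewrite big_nil; exact: cvg_cst.
  under eq_fun do rewrite big_cons; rewrite big_cons.
  apply: cvgD => //; apply: cvgMr; apply: cvgB; last exact: cvg_cst.
  exact: is_cvg_series_exp_coeff.
rewrite -(cvg_lim _ cf)//; apply: limr_ge; first by apply/cvg_ex; eexists; exact: cf.
exists m => // n /= mn; rewrite /f.
under eq_bigr do rewrite (sub_series_geq _ mn) mulr_sumr.
rewrite exchange_big /= big_nat_cond; apply: sumr_ge0 => k /andP[/andP[mk _] _].
under eq_bigr do rewrite /exp_coeff mulrA.
by rewrite -mulr_suml; apply: mulr_ge0; [exact: H|rewrite invr_ge0 ler0n].
Qed.

Definition coshR x := (expR x + expR (- x)) / 2.
Definition sinhR x := (expR x - expR (- x)) / 2.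

Lemma coshR0 : coshR 0 = 1.
Proof. by rewrite /coshR oppr0 expR0; lra. Qed.

Lemma coshR_gt0 x : 0 < coshR x.
Proof. by rewrite /coshR; have := expR_gt0 x; have := expR_gt0 (- x); lra. Qed.

Lemma coshR_norm x : coshR `|x| = coshR x.
Proof. by rewrite /coshR; case: ger0P => // _; rewrite opprK addrC. Qed.

Lemma coshRD x y : coshR (x + y) = coshR x * coshR y + sinhR x * sinhR y.
Proof. by rewrite /coshR /sinhR opprD !expRD; field. Qed.

Lemma coshRB x y : coshR (x - y) = coshR x * coshR y - sinhR x * sinhR y.
Proof. by rewrite /coshR /sinhR opprD opprK !expRD; field. Qed.

Lemma coshR_geV2 x : expR x / 2 <= coshR x.
Proof. by rewrite /coshR; have := expR_gt0 (- x); lra. Qed.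

Lemma sinhR_ge0 x : 0 <= x -> 0 <= sinhR x.
Proof.
by move=> x0; rewrite /sinhR divr_ge0// subr_ge0 ler_expR; lra.
Qed.

Lemma coshR_le_expRM x y e : `|x - y| <= e -> coshR x <= expR e * coshR y.
Proof.
move=> xye; rewrite /coshR mulrA ler_pM2r// mulrDr -!expRD lerD// ler_expR.
  by have := ler_norm (x - y); lra.
by have := ler_norm (y - x); rewrite distrC; lra.
Qed.

Lemma convex_exp (k : nat) t u w : 0 <= t <= 1 -> 0 <= u -> 0 <= w ->
  ((1 - t) * u + t * w) ^+ k <= (1 - t) * u ^+ k + t * w ^+ k.
Proof.
move=> t01 u0 w0; elim: k => [|k IH]; first by rewrite !expr0; lra.
rewrite exprS; apply: (@le_trans _ _ (((1 - t) * u + t * w) * ((1 - t) * u ^+ k + t * w ^+ k))).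
  by apply: ler_wpM2l => //; nra.
(* [t (1 - t)] times this product is the convexity defect left after the induction hypothesis;
   powers are monotone, so its factors agree in sign. *)
have H : 0 <= (u - w) * (u ^+ k - w ^+ k).
  have [uw|wu] := leP u w.
    by rewrite mulr_le0// subr_le0// lerXn2r.
  by apply: mulr_ge0; rewrite subr_ge0 ?lerXn2r// ltW.
rewrite !exprS -subr_ge0.
have -> : (1 - t) * (u * u ^+ k) + t * (w * w ^+ k) -
  ((1 - t) * u + t * w) * ((1 - t) * u ^+ k + t * w ^+ k) =
  (t * (1 - t)) * ((u - w) * (u ^+ k - w ^+ k)) by ring.
by apply: mulr_ge0 => //; nra.
Qed.

(* [s |-> cosh (sqrt s)] is convex and nondecreasing, its power series having
   nonnegative coefficients. *)
Lemma coshR_sqr_convex t u w q : 0 <= t <= 1 ->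
  q ^+ 2 <= (1 - t) * u ^+ 2 + t * w ^+ 2 ->
  coshR q <= (1 - t) * coshR u + t * coshR w.
Proof.
move=> t01 H.
(* Each point occurs with its opposite, so odd powers cancel; the even ones reduce to the convexity
   of powers at the squares. *)
have := @expR_comb_tail_ge0 0
  [:: (1 - t, u); (1 - t, - u); (t, w); (t, - w); (-1, q); (-1, - q)].
rewrite !big_cons big_nil /= /series/= !big_geq// !subr0 /coshR.
move=> K; suff : forall k : nat, (0 <= k)%N -> 0 <=
    \sum_(i <- [:: (1 - t, u); (1 - t, - u); (t, w); (t, - w); (-1, q); (-1, - q)])
      i.1 * i.2 ^+ k.
  by move=> {}/K; clear; lra.
move=> k _; rewrite !big_cons big_nil/= (exprNn u) (exprNn w) (exprNn q).
have [ok|/even_halfK <-] := boolP (odd k); first by rewrite -signr_odd ok expr1; lra.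
rewrite -signr_odd odd_double expr0 -mul2n !exprM.
suff : q ^+ 2 ^+ k./2 <= (1 - t) * u ^+ 2 ^+ k./2 + t * w ^+ 2 ^+ k./2 by lra.
apply: le_trans (convex_exp _ _ _ _); rewrite ?sqr_ge0//.
by apply: lerXn2r; rewrite ?nnegrE ?sqr_ge0// (le_trans _ H)// sqr_ge0.
Qed.

Lemma le_coshR x y : `|x| <= `|y| -> coshR x <= coshR y.
Proof.
move=> xy; have := @coshR_sqr_convex 0 y 0 x.
rewrite subr0 mul0r !addr0 !mul1r; rewrite lexx ler01 /= mul0r addr0; apply => //.
by rewrite -real_normK ?num_real// -(real_normK (num_real y)) lerXn2r ?nnegrE.
Qed.

Lemma sinhR_ge x : 0 <= x -> x <= sinhR x.
Proof.
move=> x0; have := @expR_comb_tail_ge0 2 [:: (1, x); (-1, - x)].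
rewrite !big_cons !big_nil /= /series/= !big_nat_recr//= !big_geq//
  /exp_coeff/= !expr0 !expr1 !divr1 /sinhR.
suff H : forall k, (2 <= k)%N -> 0 <= \sum_(i <- [:: (1, x); (-1, - x)]) i.1 * i.2 ^+ k.
  by move=> /(_ H); lra.
move=> k _; rewrite !big_cons big_nil/= exprNn -signr_odd.
by have := exprn_ge0 k x0; case: odd => /=; rewrite ?expr0 ?expr1; lra.
Qed.

Lemma expR_ge_deg2 x : 0 <= x -> x ^+ 2 / 2 <= expR x - 1 - x.
Proof.
move=> x0; have := @expR_comb_tail_ge0 3 [:: (1, x)].
rewrite !big_cons !big_nil /= /series/= !big_nat_recr//= !big_geq//
  /exp_coeff/= !expr0 !expr1 !divr1.
suff H : forall k, (3 <= k)%N -> 0 <= \sum_(i <- [:: (1, x)]) i.1 * i.2 ^+ k.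
  by move=> /(_ H); rewrite (_ : 2`!%:R = 2 :> R)//; lra.
by move=> k _; rewrite !big_cons big_nil/=; have := exprn_ge0 k x0; lra.
Qed.

(** Every Taylor term of [(e^x - 1 - x) / x^2] is nondecreasing for [x >= 0]; clearing denominators
    admits [x = 0]. This lets the size of an increment be replaced by its bound [c]. *)
Lemma expR_tail2_mono x y : 0 <= x -> x <= y ->
  (expR x - 1 - x) * y ^+ 2 <= (expR y - 1 - y) * x ^+ 2.
Proof.
move=> x0 xy; have := @expR_comb_tail_ge0 2 [:: (x ^+ 2, y); (- y ^+ 2, x)].
rewrite !big_cons !big_nil /= /series/= !big_nat_recr//= !big_geq//
  /exp_coeff/= !expr0 !expr1 !divr1.
suff H : forall k, (2 <= k)%N -> 0 <= \sum_(i <- [:: (x ^+ 2, y); (- y ^+ 2, x)]) i.1 * i.2 ^+ k.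
  by move=> /(_ H); lra.
move=> k k2; rewrite !big_cons big_nil/= addr0 -(subnKC k2) !exprD.
have -> : x ^+ 2 * (y ^+ 2 * y ^+ (k - 2)) + - y ^+ 2 * (x ^+ 2 * x ^+ (k - 2)) =
   (x * y) ^+ 2 * (y ^+ (k - 2) - x ^+ (k - 2)) by ring.
by rewrite mulr_ge0 ?sqr_ge0// subr_ge0 lerXn2r ?nnegrE// (le_trans x0).
Qed.

Lemma ge0_is_derive_le (f f' : R -> R) x :
  (forall y, 0 <= y -> is_derive y (1 : R) f (f' y)) ->
  (forall y, 0 <= y -> 0 <= f' y) -> 0 <= x -> f 0 <= f x.
Proof.
move=> df f'0 x0; apply: (@ger0_derive1_ndecry _ f 0) => //.
- by move=> y; rewrite in_itv/= andbT => y0; have [] := df y (ltW y0).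
- move=> y; rewrite in_itv/= andbT => y0; rewrite derive1E.
  have [_ ->] := df y (ltW y0); exact: f'0 (ltW y0).
- apply: derivable_within_continuous => y; rewrite in_itv/= andbT => y0.
  by have [] := df y y0.
Qed.

Lemma sinhR_le x : 0 <= x -> sinhR x <= x * coshR x.
Proof.
move=> x0; rewrite -subr_ge0.
have := @ge0_is_derive_le (fun x => x * coshR x - sinhR x) (fun x => x * sinhR x) x.
rewrite mul0r /sinhR oppr0 subrr mul0r subrr; apply => // y y0; last first.
  by rewrite mulr_ge0// sinhR_ge0.
rewrite /coshR; apply: is_derive_eq; rewrite /GRing.scale/=; ring.
Qed.

Lemma coshR_le_expR_sqr x : coshR x <= expR (x ^+ 2 / 2).
Proof.
rewrite -coshR_norm -real_normK ?num_real//; move: `|x| (normr_ge0 x) => {}x x0.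
have := @ge0_is_derive_le (fun x => - (coshR x * expR (- (x ^+ 2 / 2))))
   (fun x => (x * coshR x - sinhR x) * expR (- (x ^+ 2 / 2))) x.
rewrite coshR0 expr0n/= mul0r oppr0 expR0 mulr1 expRN lerN2.
rewrite ler_pdivrMr ?expR_gt0// mul1r; apply => // y y0; last first.
  by rewrite mulr_ge0 ?expR_ge0// subr_ge0 sinhR_le.
rewrite /coshR /sinhR; by apply: is_derive_eq; rewrite /GRing.scale/=; field.
Qed.

Lemma is_derive_addl (c z : R) : is_derive z (1 : R) (fun z => c + z) 1.
Proof.
by have := is_deriveD (is_derive_cst c z 1) (is_derive_id z (1 : R)); rewrite add0r.
Qed.

Lemma is_derive_ln_addl (c z : R) : 0 < c + z ->
  is_derive z (1 : R) (fun z => ln (c + z)) (c + z)^-1.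
Proof.
move=> cz; have dl := is_derive1_ln cz.
by have := is_derive1_comp dl (is_derive_addl c z); rewrite mulr1.
Qed.

Lemma is_derive_inv_addl (c z : R) : c + z != 0 ->
  is_derive z (1 : R) (fun z => (c + z)^-1) (- (c + z) ^- 2).
Proof.
move=> cz; have := @is_deriveV _ (fun z => c + z) z 1 1 cz (is_derive_addl c z).
by rewrite /GRing.scale /= mulr1.
Qed.

Lemma bennett_bernstein y : 0 <= y ->
  y ^+ 2 / (2 * (1 + y / 3)) <= (1 + y) * ln (1 + y) - y.
Proof.
move=> y0; rewrite -subr_ge0.
(* The derivative of the difference of the two sides, the left one being [3/2 y^2 / (3 + y)]. Its
   own derivative is nonnegative because [(3 + y)^3 - 27 (1 + y) = y^2 (9 + y)]. *)
pose h' (y : R) := ln (1 + y) - 3 / 2 * ((6 * y + y ^+ 2) / (3 + y) ^+ 2).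
have h'00 : h' 0 = 0.
  by rewrite /h' addr0 ln1 !(mulr0, expr0n)/= addr0 mul0r mulr0 subr0.
have h'0 x : 0 <= x -> 0 <= h' x.
  move=> x0; have := @ge0_is_derive_le h' (fun x => (1 + x)^-1 - 27 / (3 + x) ^+ 3) x.
  rewrite h'00; apply => // z z0; last first.
    rewrite subr_ge0 ler_pdivrMr; last by apply: exprn_gt0; lra.
    rewrite mulrC ler_pdivlMr; last lra.
    by nra.
  have z1 : 0 < 1 + z by lra.
  have z3 : 3 + z != 0 by apply: lt0r_neq0; lra.
  have d1 := is_derive_ln_addl z1.
  have d2 := is_derive_inv_addl z3.
  have -> : h' = fun z => ln (1 + z) - 3 / 2 * ((6 * z + z ^+ 2) * ((3 + z)^-1 * (3 + z)^-1)).
    by apply/funext => u; rewrite /h' expr2 invfM.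
  apply: is_derive_eq; rewrite /GRing.scale/=. field.
  by rewrite z3 lt0r_neq0.
have := @ge0_is_derive_le (fun y => (1 + y) * ln (1 + y) - y - 3 / 2 * (y ^+ 2 * (3 + y)^-1)) h' y.
rewrite addr0 ln1 !(mulr0, expr0n)/= mul0r mulr0 !subr0.
have -> : y ^+ 2 / (2 * (1 + y / 3)) = 3 / 2 * (y ^+ 2 / (3 + y)).
  by field; rewrite !lt0r_neq0//; lra.
apply => // z z0.
have z1 : 0 < 1 + z by lra.
have z3 : 3 + z != 0 by apply: lt0r_neq0; lra.
have d1 := is_derive_ln_addl z1.
have d2 := is_derive_inv_addl z3.
apply: is_derive_eq; rewrite /h' /GRing.scale/=. field.
by rewrite z3 lt0r_neq0.
Qed.

End hyperbolic.

(** * Bounds on cosh under a quadratic constraint *)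

Section exponential_step.
Variable R : realType.
Implicit Types (a b p q l del z : R).

(* The bound is affine in [l] and agrees with [cosh (p +- b)] at [l = +- 2 p b]. *)
Lemma coshR_affine_bound p b l z : 0 <= p -> 0 <= b -> `|l| <= 2 * p * b ->
  z ^+ 2 <= p ^+ 2 + l + b ^+ 2 ->
  coshR z <= coshR p * coshR b + l * (sinhR p * sinhR b / (2 * p * b)).
Proof.
move=> p0 b0 lpb zle.
have [pb0|pb0] := eqVneq (p * b) 0.
  have l0 : l = 0 by apply/eqP; rewrite -normr_le0; move: lpb; rewrite -mulrA pb0 mulr0.
  rewrite l0 mul0r addr0.
  move/eqP: pb0; rewrite mulf_eq0 => /orP[] /eqP E; move: zle;
    rewrite l0 E coshR0 ?(mul1r, mulr1) expr0n/= !(add0r, addr0) => zle;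
    apply: le_coshR; by rewrite -(@ler_pXn2r _ 2)// ?nnegrE// !real_normK ?num_real.
have k0 : 0 < 2 * p * b by rewrite -mulrA mulr_gt0// lt_neqAle eq_sym pb0 mulr_ge0.
(* The weight that makes [(1 - t) (p - b)^2 + t (p + b)^2] equal to [p^2 + l + b^2]. *)
pose t := (1 + l / (2 * p * b)) / 2.
have t01 : 0 <= t <= 1.
  have : `|l / (2 * p * b)| <= 1.
    by rewrite normrM normfV (gtr0_norm k0) ler_pdivrMr// mul1r.
  rewrite ler_norml /t; lra.
have pn : p != 0 by apply: contraNneq pb0 => ->; rewrite mul0r.
have bn : b != 0 by apply: contraNneq pb0 => ->; rewrite mulr0.
apply: (le_trans (@coshR_sqr_convex _ t (p - b) (p + b) z t01 _)).
  apply: (le_trans zle); rewrite le_eqVlt; apply/orP; left; apply/eqP.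
  by rewrite /t; field; rewrite ?pn ?bn.
rewrite coshRB coshRD le_eqVlt; apply/orP; left; apply/eqP.
by rewrite /t; field; rewrite ?pn ?bn.
Qed.

(** The slope in [coshR_affine_bound] depends on the increment size [a], which would spoil linearity
    in the increment. It is replaced by its limit [sinh p / (2 p)] as [a] tends to 0. With
    [r = l / (2 p a) <= 1] the new bound exceeds the old one by
    [(cosh p - r sinh p) (sinh a - a) >= 0]. *)
Lemma coshR_quadratic_bound1 p a l z : 0 <= p -> 0 <= a -> `|l| <= 2 * p * a ->
  z ^+ 2 <= p ^+ 2 + l + a ^+ 2 ->
  coshR z <= coshR p + l * (sinhR p / (2 * p)) + (expR a - 1 - a) * coshR p.
Proof.
move=> p0 a0 lpa zle; apply: (le_trans (coshR_affine_bound p0 a0 lpa zle)).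
have Sp := sinhR_ge0 p0.
have Cp := coshR_gt0 p.
have aS := sinhR_ge a0.
have -> : expR a = coshR a + sinhR a by rewrite /coshR /sinhR; field.
have K : 0 <= (coshR p - sinhR p) * (sinhR a - a).
  apply: mulr_ge0; last by rewrite subr_ge0.
  rewrite (_ : coshR p - sinhR p = expR (- p)) ?expR_ge0//.
  by rewrite /coshR /sinhR; field.
have [pa0|pa0] := eqVneq (p * a) 0.
  have l0 : l = 0 by apply/eqP; rewrite -normr_le0; move: lpa; rewrite -mulrA pa0 mulr0.
  rewrite l0 !mul0r; nra.
have pn : p != 0 by apply: contraNneq pa0 => ->; rewrite mul0r.
have an : a != 0 by apply: contraNneq pa0 => ->; rewrite mulr0.
have k0 : 0 < 2 * p * a by rewrite -mulrA mulr_gt0// lt_neqAle eq_sym pa0 mulr_ge0.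
set r := l / (2 * p * a).
have : `|r| <= 1 by rewrite normrM normfV (gtr0_norm k0) ler_pdivrMr// mul1r.
rewrite ler_norml => /andP[_ r1].
have -> : l * (sinhR p * sinhR a / (2 * p * a)) = r * sinhR p * sinhR a.
  by rewrite /r; field; rewrite ?pn ?an.
have -> : l * (sinhR p / (2 * p)) = r * sinhR p * a.
  by rewrite /r; field; rewrite ?pn ?an.
have : 0 <= (1 - r) * (sinhR p * (sinhR a - a)).
  by apply: mulr_ge0; [rewrite subr_ge0|apply: mulr_ge0 => //; rewrite subr_ge0].
nra.
Qed.

(* The two bounds on [z ^ 2] are interpolated between [del = 1] and the value of
   [del] at which they coincide. *)
Lemma coshR_quadratic_bound p a l del z :
  0 <= p -> 0 <= a -> `|l| <= 2 * p * a -> 1 <= del ->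
  z ^+ 2 <= p ^+ 2 + l + del * a ^+ 2 -> `|z| <= p + a ->
  coshR z <=
    coshR p + l * (sinhR p / (2 * p)) + del * (expR a - 1 - a) * coshR p.
Proof.
move=> p0 a0 lpa del1 z1 z2.
have Cp := coshR_gt0 p.
have Ea := expR_ge_deg2 a0.
have E0 : 0 <= expR a - 1 - a by apply: le_trans Ea; rewrite divr_ge0 ?sqr_ge0.
set E := expR a - 1 - a in Ea E0 *.
have zpa : z ^+ 2 <= (p + a) ^+ 2.
  by rewrite -real_normK ?num_real// lerXn2r ?nnegrE// addr_ge0.
have [lpaE|lpaE] := eqVneq l (2 * p * a).
  apply: (le_trans (coshR_quadratic_bound1 p0 a0 lpa (_ : z ^+ 2 <= _))).
    by apply: (le_trans zpa); rewrite lpaE; lra.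
  by rewrite lerD2l// -/E -[leLHS]mul1r -mulrA ler_wpM2r// mulr_ge0// ltW.
have lt_l : 0 < 2 * p * a - l.
  by rewrite subr_gt0 lt_neqAle lpaE/=; apply: le_trans lpa; exact: ler_norm.
pose k := sinhR p / (2 * p).
have k0 : 0 <= k by rewrite divr_ge0 ?sinhR_ge0// mulr_ge0.
have kC : 2 * k <= coshR p.
  rewrite /k; have [->|pn] := eqVneq p 0.
    by rewrite mulr0 invr0 !mulr0 coshR0.
  have pp : 0 < p by rewrite lt_neqAle eq_sym pn.
  rewrite (_ : 2 * _ = sinhR p / p); last by field.
  by rewrite ler_pdivrMr// mulrC sinhR_le.
(* Raising [t] from 0 to 1 moves the bound on [z^2] from [p^2 + l + a^2] up to [(p + a)^2]; it stops
   at whichever of the two hypotheses on [z] is reached first. *)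
pose t := Num.min 1 ((del - 1) * a ^+ 2 / (2 * p * a - l)).
have t0 : 0 <= t.
  rewrite le_min ler01 /=; apply: divr_ge0; last exact: ltW.
  by apply: mulr_ge0; rewrite ?sqr_ge0// subr_ge0.
have t1 : t <= 1 by rewrite ge_min lexx.
have t01 : 0 <= t <= 1 by rewrite t0.
have td : t * (2 * p * a - l) <= (del - 1) * a ^+ 2.
  by rewrite -ler_pdivlMr// ge_min lexx orbT.
have u0 : 0 <= p ^+ 2 + l + a ^+ 2.
  move: lpa; rewrite ler_norml => /andP[ll _].
  by have := sqr_ge0 (p - a); rewrite sqrrB; nra.
pose u := Num.sqrt (p ^+ 2 + l + a ^+ 2).
have uE : u ^+ 2 = p ^+ 2 + l + a ^+ 2 by rewrite sqr_sqrtr.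
have zt : z ^+ 2 <= (1 - t) * u ^+ 2 + t * (p + a) ^+ 2.
  have -> : (1 - t) * u ^+ 2 + t * (p + a) ^+ 2 =
    p ^+ 2 + l + a ^+ 2 + t * (2 * p * a - l) by rewrite uE; ring.
  rewrite /t minEle; case: ifP => _; first by apply: (le_trans zpa); lra.
  by rewrite divfK ?gt_eqF//; move: z1; lra.
apply: (le_trans (coshR_sqr_convex t01 zt)).
have b1 : coshR u <= coshR p + l * k + E * coshR p.
  by apply: coshR_quadratic_bound1 => //; rewrite uE.
have b2 : coshR (p + a) <= coshR p + 2 * p * a * k + E * coshR p.
  apply: coshR_quadratic_bound1 => //; last by rewrite le_eqVlt; apply/orP; left; apply/eqP; ring.
  by rewrite ger0_norm// !mulr_ge0.
rewrite -/k.
have H1 : (1 - t) * coshR u <= (1 - t) * (coshR p + l * k + E * coshR p).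
  by apply: ler_wpM2l => //; rewrite subr_ge0.
have H2 : t * coshR (p + a) <= t * (coshR p + 2 * p * a * k + E * coshR p).
  exact: ler_wpM2l.
have H3 : t * (2 * p * a - l) * k <= (del - 1) * a ^+ 2 * k by apply: ler_wpM2r.
(* Interpolation costs at most [(del - 1) a^2 k]. The additional [(del - 1) E cosh p] absorbs it,
   since [2 k <= cosh p] and [a^2 / 2 <= E]. *)
have H4 : (del - 1) * (a ^+ 2 * k) <= (del - 1) * (E * coshR p).
  apply: ler_wpM2l; first by rewrite subr_ge0.
  apply: (@le_trans _ _ (a ^+ 2 / 2 * coshR p)); last by rewrite ler_wpM2r// ltW.
  by rewrite -mulrA ler_wpM2l ?sqr_ge0//; lra.
lra.
Qed.

End exponential_step.

(** * Supergradients *)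

Section additive_minorant.
Variables (R : realType) (X : zmodType).
Implicit Types (f p : X -> R) (u v : X).

(** Sublinearity over the natural numbers: the two clauses together give [f (n v) = n f v]. Only the
    additive group is involved, which suits the limit of dyadic quotients; real scalars return in
    [additive_bounded_scalar]. *)
Definition subadditive_natmul f :=
  (forall u v, f (u + v) <= f u + f v) /\
  (forall n v, n%:R * f v <= f (v *+ n)).

Lemma subadditive_natmul0 f : subadditive_natmul f -> f 0 = 0.
Proof.
move=> [_ fM]; have := fM 0%N 0; have := fM 2%N 0.
by rewrite mul0rn mul0r => ? ?; lra.
Qed.

Lemma subadditive_natmul_oppr_ge f v : subadditive_natmul f -> - f v <= f (- v).
Proof.
move=> sf; have [fD _] := sf.
by have := fD v (- v); rewrite subrr subadditive_natmul0//; lra.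
Qed.

Lemma subadditive_natmul_le f n v : subadditive_natmul f -> f (v *+ n) <= n%:R * f v.
Proof.
move=> sf; elim: n => [|n IH]; first by rewrite mulr0n subadditive_natmul0// mul0r.
by rewrite mulrSr; apply: (le_trans (sf.1 _ _)); rewrite -natr1; lra.
Qed.

(* Along the ray [n |-> u + n v] the quotients [f (u + n v) - n f v] decrease, and
   passing to their infimum replaces [f] by a smaller map that is additive in
   the direction [v]. *)
Lemma subadditive_natmul_descent f v : subadditive_natmul f ->
  exists f', [/\ subadditive_natmul f', (forall u, f' u <= f u) &
    f' (- v) <= - f v].
Proof.
move=> sf; have [fD fM] := sf.
pose E u := [set f (u + v *+ n) - n%:R * f v | n in [set: nat]].
have E0 u : E u !=set0 by exists (f (u + v *+ 0) - 0%:R * f v); exists 0%N.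
have lbE u : lbound (E u) (- f (- u)).
  move=> _ [n _ <-]; have := fD (u + v *+ n) (- u).
  by rewrite addrAC subrr add0r; have := fM n v; lra.
have leE u n : inf (E u) <= f (u + v *+ n) - n%:R * f v.
  by apply: ge_inf; [exists (- f (- u)); exact: lbE|exists n].
exists (fun u => inf (E u)); split.
- split.
    move=> u w; rewrite -lerBlDr; apply: lb_le_inf => // _ [n _ <-].
    rewrite lerBlDr -lerBlDl; apply: lb_le_inf => // _ [m _ <-].
    have := leE (u + w) (n + m)%N; have := fD (u + v *+ n) (w + v *+ m).
    by rewrite addrACA -mulrnDr natrD; lra.
  move=> [|k] u.
    rewrite mul0r mulr0n; apply: lb_le_inf => // _ [n _ <-].
    by rewrite add0r subr_ge0.
  apply: lb_le_inf => // _ [n _ <-].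
  apply: (@le_trans _ _ (k.+1%:R * (f (u + v *+ n) - n%:R * f v))).
    by rewrite ler_pM2l// ltr0Sn.
  have := fM k.+1 (u + v *+ n).
  rewrite mulrnDl -mulrnA mulnS mulrnDr addrA.
  have := fD (u *+ k.+1 + v *+ n) (v *+ (n * k)).
  have := subadditive_natmul_le (n * k) v sf.
  by rewrite natrM -natr1; nra.
- by move=> u; have := leE u 0%N; rewrite mul0r subr0 mulr0n addr0.
- have := leE (- v) 1%N; rewrite mul1r mulr1n addNr subadditive_natmul0//; lra.
Qed.

(* Hahn-Banach: by Zorn's lemma there is a minimal map below [p], and by the
   preceding descent a minimal map is additive. *)
Lemma additive_minorant p : subadditive_natmul p ->
  exists L : X -> R, (forall u v, L (u + v) = L u + L v) /\ forall v, L v <= p v.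
Proof.
move=> sp.
pose T := {f : X -> R | subadditive_natmul f /\ forall v, f v <= p v}.
(* The order is reversed, so a maximal element for [Zorn] is a minimal function. *)
pose le_fun (s t : T) := `[< forall v, sval t v <= sval s v >].
have [| | | |[f [sf fp]] fmin] := @Zorn T le_fun.
- by move=> t; apply/asboolP.
- move=> r s t /asboolP rs /asboolP st; apply/asboolP => v.
  exact: le_trans (st v) (rs v).
- move=> [f hf] [g hg] /asboolP/= fg /asboolP/= gf.
  have E : f = g by apply/funext => v; apply/eqP; rewrite eq_le fg gf.
  by subst g; congr exist; exact: Prop_irrelevance.
- move=> A Atot; have [[a Aa]|/set0P/negP/negPn/eqP A0] := pselect (A !=set0); last first.
    by exists (exist _ p (conj sp (fun=> lexx _))) => s; rewrite A0.
  pose E v := [set sval s v | s in A].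
  have E0 v : E v !=set0 by exists (sval a v); exists a.
  have lbE v : lbound (E v) (- p (- v)).
    move=> _ [[g [sg gp]] _ <-]/=.
    have := gp (- v); have := subadditive_natmul_oppr_ge v sg.
    by have := subadditive_natmul_oppr_ge (- v) sg; rewrite opprK; lra.
  have leE v s : A s -> inf (E v) <= sval s v.
    by move=> As; apply: ge_inf; [exists (- p (- v)); exact: lbE|exists s].
  have sE : subadditive_natmul (fun v => inf (E v)).
    split.
      move=> u w; rewrite -lerBlDr; apply: lb_le_inf => // _ [s As <-].
      rewrite lerBlDr -lerBlDl; apply: lb_le_inf => // _ [t At <-].
      have [/asboolP st|/asboolP ts] := Atot _ _ As At.
        have := leE (u + w) t At; have := (svalP t).1.1 u w; have := st u; lra.
      have := leE (u + w) s As; have := (svalP s).1.1 u w; have := ts w; lra.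
    move=> n v; apply: lb_le_inf => // _ [s As <-].
    by apply: le_trans ((svalP s).1.2 n v); rewrite ler_wpM2l ?ler0n// leE.
  have Ep v : inf (E v) <= p v by apply: le_trans (leE v a Aa) _; exact: (svalP a).2.
  pose t : T := exist (fun f => subadditive_natmul f /\ forall v, f v <= p v) _ (conj sE Ep).
  by exists t => s As; apply/asboolP => v; exact: leE.
- exists f; split => //.
  have fN v : f (- v) = - f v.
    apply/eqP; rewrite eq_le subadditive_natmul_oppr_ge// andbT.
    have [f' [sf' f'f f'v]] := subadditive_natmul_descent v sf.
    have f'p u : f' u <= p u by exact: le_trans (f'f u) (fp u).
    have E := congr1 sval (fmin (exist _ f' (conj sf' f'p)) (asboolT f'f)).
    by rewrite -[f in f (- v)]E.
  move=> u v; apply/eqP; rewrite eq_le sf.1/=.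
  by have := sf.1 (u + v) (- v); rewrite addrK fN; lra.
Qed.

End additive_minorant.

Section supergradient.
Variables (R : realType) (X : normedModType R).
Implicit Types (u v w x : X).

(** Additivity gives homogeneity over the integers. Splitting [N a] into its floor and a remainder
    in [[0, 1]] bounds [N |L (a v) - a L v|] by [2 C |v|], for arbitrarily large [N]. *)
Lemma additive_bounded_scalar (L : X -> R) (C : R) :
  (forall u v, L (u + v) = L u + L v) -> (forall v, `|L v| <= C * `|v|) -> scalar L.
Proof.
move=> LD LC.
have L0 : L 0 = 0 by have := LD 0 0; rewrite addr0; lra.
have LN v : L (- v) = - L v by have := LD v (- v); rewrite subrr L0; lra.
have Ln n v : L (v *+ n) = n%:R * L v.
  elim: n => [|n IH]; first by rewrite mulr0n mul0r.
  by rewrite mulrSr LD IH -natr1; ring.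
have Lz (z : int) v : L (z%:~R *: v) = z%:~R * L v.
  case: z => n; rewrite ?NegzE ?mulrNz ?scaleNr ?LN ?mulNr -?pmulrn scaler_nat Ln//.
have LZ a v : L (a *: v) = a * L v.
  apply/eqP; rewrite -subr_eq0 -normr_le0; apply/ler_addgt0Pr => e e0; rewrite add0r.
  pose N := (Num.truncn (2 * (C * `|v|) / e)).+1.
  have N0 : 0 < N%:R :> R by rewrite ltr0Sn.
  have Ne : 2 * (C * `|v|) <= N%:R * e.
    by rewrite -ler_pdivrMr//; apply/ltW; exact: truncnS_gt.
  rewrite -(ler_pM2l N0); apply: le_trans Ne.
  rewrite -{1}(ger0_norm (ltW N0)) -normrM mulrBr -Ln -scaler_nat scalerA.
  pose z := Num.floor (N%:R * a).
  have zl : z%:~R <= N%:R * a by exact: floor_le_tmp.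
  have zu : N%:R * a < z%:~R + 1 by rewrite -intrD1 floorD1_gt.
  pose r := N%:R * a - z%:~R.
  have r01 : `|r| <= 1 by rewrite ger0_norm /r; lra.
  rewrite (_ : N%:R * a = r + z%:~R); last by rewrite /r; ring.
  rewrite scalerDl LD Lz mulrA (_ : N%:R * a = r + z%:~R); last by rewrite /r; ring.
  rewrite (_ : _ - _ = L (r *: v) - r * L v); last by ring.
  have C0 : 0 <= C * `|v| by apply: le_trans (LC v).
  apply: (le_trans (ler_normB _ _)).
  rewrite (_ : 2 * (C * `|v|) = C * `|v| + C * `|v|); last by ring.
  apply: lerD.
    apply: (le_trans (LC _)); rewrite normrZ mulrCA -[leRHS]mul1r.
    exact: ler_wpM2r.
  by rewrite normrM -[leRHS]mul1r ler_pM.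
by move=> a u v; rewrite LD LZ.
Qed.

Lemma cvg_half_pow (k : R) : (fun n : nat => k * 2 ^- n) @ \oo --> (0 : R).
Proof.
rewrite -(mulr0 k); apply: cvgMr.
have -> : (fun n : nat => 2 ^- n : R) = GRing.exp 2^-1.
  by apply/funext => n; rewrite exprVn.
by apply: cvg_expr; rewrite ger0_norm; lra.
Qed.

Definition dyadic_quotient (g : X -> R) x (n : nat) v : R :=
  2 ^+ n * (g (x + 2 ^- n *: v) - g x).

Variables (g : X -> R) (x : X) (K C C' : R).
Hypothesis g_smooth : forall y v, g (y + v) - 2 * g y + g (y - v) <= 2 * K * `|v| ^+ 2.
Hypothesis g_bound : forall v, `|g (x + v) - g x| <= C * `|v| + C' * `|v| ^+ 2.

Local Notation b := (dyadic_quotient g x).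

Lemma expr2n_neq0 n : 2 ^+ n != 0 :> R. Proof. by rewrite expf_neq0. Qed.

(** The points [x + 2^-n v] and [x + 2^-n w] lie symmetrically about [x + 2^-(n+1) (v + w)], so the
    second difference there compares level [n] with level [n + 1]. *)
Lemma dyadic_quotientD n v w :
  b n v + b n w <= b n.+1 (v + w) + K / 2 * `|v - w| ^+ 2 * 2 ^- n.
Proof.
have := g_smooth (x + 2 ^- n.+1 *: (v + w)) (2 ^- n.+1 *: (v - w)).
have E u : 2 ^- n.+1 *: u + 2 ^- n.+1 *: u = 2 ^- n *: u :> X.
  rewrite -scalerDl; congr (_ *: _).
  by rewrite exprS; field; exact: expr2n_neq0.
have -> : x + 2 ^- n.+1 *: (v + w) + 2 ^- n.+1 *: (v - w) = x + 2 ^- n *: v.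
  by rewrite -E -addrA !scalerDr scalerN addrACA subrr addr0.
have -> : x + 2 ^- n.+1 *: (v + w) - 2 ^- n.+1 *: (v - w) = x + 2 ^- n *: w.
  by rewrite -E -addrA !scalerDr scalerN opprB (addrC (2 ^- n.+1 *: w)) addrACA subrr add0r.
rewrite normrZ (@ger0_norm _ (2 ^- n.+1)) ?invr_ge0 ?exprn_ge0// => H.
rewrite /dyadic_quotient -subr_ge0.
have -> : 2 ^+ n.+1 * (g (x + 2 ^- n.+1 *: (v + w)) - g x) +
   K / 2 * `|v - w| ^+ 2 * 2 ^- n -
   (2 ^+ n * (g (x + 2 ^- n *: v) - g x) + 2 ^+ n * (g (x + 2 ^- n *: w) - g x)) =
   2 ^+ n * (2 * K * (2 ^- n.+1 * `|v - w|) ^+ 2 -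
     (g (x + 2 ^- n *: v) - 2 * g (x + 2 ^- n.+1 *: (v + w)) + g (x + 2 ^- n *: w))).
  rewrite !exprS expr0; field; exact: expr2n_neq0.
by rewrite mulr_ge0 ?exprn_ge0// subr_ge0.
Qed.

Lemma dyadic_quotient_double n v : b n.+1 (v *+ 2) = 2 * b n v.
Proof.
rewrite /dyadic_quotient -(scaler_nat 2 v) scalerA exprS.
rewrite (_ : (2 * 2 ^+ n)^-1 * 2%:R = 2 ^- n) ?mulrA//.
by field; exact: expr2n_neq0.
Qed.

Lemma dyadic_quotient0 n : b n 0 = 0.
Proof. by rewrite /dyadic_quotient scaler0 addr0 subrr mulr0. Qed.

Lemma dyadic_quotient_bound n v : `|b n v| <= C * `|v| + C' * `|v| ^+ 2 * 2 ^- n.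
Proof.
have p0 : 0 <= 2 ^+ n :> R by rewrite exprn_ge0.
rewrite normrM (ger0_norm p0); apply: (le_trans (ler_wpM2l p0 (g_bound _))).
rewrite normrZ ger0_norm ?invr_ge0// le_eqVlt; apply/orP; left; apply/eqP.
by field; exact: expr2n_neq0.
Qed.

(** For [w = 0] the error in [dyadic_quotientD] is exactly the drop of the correction from [n] to
    [n + 1]. *)
Lemma dyadic_quotient_corrected_ndecr v :
  nondecreasing_seq (fun n => b n v - K * `|v| ^+ 2 * 2 ^- n).
Proof.
apply/nondecreasing_seqP => n.
have := dyadic_quotientD n v 0; rewrite dyadic_quotient0 addr0 subr0 addr0 (exprS 2 n) invfM.
lra.
Qed.

Lemma dyadic_quotient_cvg v : exists l : R,
  [/\ b ^~ v @ \oo --> l, g (x + v) - g x - K * `|v| ^+ 2 <= l & `|l| <= C * `|v|].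
Proof.
have nd := dyadic_quotient_corrected_ndecr v.
have cv : cvgn (fun n => b n v - K * `|v| ^+ 2 * 2 ^- n).
  apply: nondecreasing_is_cvgn => //.
  exists (C * `|v| + `|C'| * `|v| ^+ 2 + `|K| * `|v| ^+ 2) => _ [n _ <-].
  have h0 : 0 <= 2 ^- n :> R by rewrite invr_ge0 exprn_ge0.
  have h1 : 2 ^- n <= 1 :> R by rewrite invf_le1 ?exprn_gt0// exprn_ege1// ler1n.
  have := dyadic_quotient_bound n v; rewrite ler_norml => /andP[_ H].
  rewrite lerD//.
    apply: (le_trans H); rewrite lerD2l; apply: (@le_trans _ _ (`|C'| * `|v| ^+ 2 * 2 ^- n)).
      by rewrite !ler_wpM2r ?sqr_ge0// ler_norm.
    by rewrite ler_piMr// mulr_ge0 ?sqr_ge0.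
  rewrite -mulNr -mulNr; apply: (@le_trans _ _ (`|K| * `|v| ^+ 2 * 2 ^- n)).
    by rewrite !ler_wpM2r ?sqr_ge0// -normrN ler_norm.
  by rewrite ler_piMr// mulr_ge0 ?sqr_ge0.
exists (limn (fun n => b n v - K * `|v| ^+ 2 * 2 ^- n)).
have bl : b ^~ v @ \oo --> limn (fun n => b n v - K * `|v| ^+ 2 * 2 ^- n).
  have := cvgD cv (cvg_half_pow (K * `|v| ^+ 2)).
  rewrite addr0 (_ : (fun n => _) + _ = b ^~ v); first by apply.
  by apply/funext => n; rewrite fctE/= subrK.
split => //.
  (* The term of index 0 is [g (x + v) - g x - K |v|^2]; that it lies below the limit is the
     one-sided quadratic bound. *)
  have := nondecreasing_cvgn_le nd cv 0%N.
  by rewrite /dyadic_quotient expr0 invr1 mulr1 mul1r scale1r.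
apply: (ler_cvg_to (cvg_norm bl)
  (_ : (fun n => C * `|v| + C' * `|v| ^+ 2 * 2 ^- n) @ \oo --> C * `|v|)).
  rewrite -[X in _ --> X]addr0; apply: cvgD; [exact: cvg_cst|exact: cvg_half_pow].
by apply: nearW => n; exact: dyadic_quotient_bound.
Qed.

(* The dyadic quotients increase, up to a vanishing correction, to a
   superadditive map; a linear majorant of it is a supergradient. *)
Lemma supergradient : exists L : X -> R,
  [/\ scalar L, (forall v, `|L v| <= C * `|v|) &
    forall v, g (x + v) <= g x + L v + K * `|v| ^+ 2].
Proof.
have [q qP] := choice dyadic_quotient_cvg.
have qcv v : b ^~ v @ \oo --> q v by have [] := qP v.
have qD v w : q v + q w <= q (v + w).
  apply: (ler_cvg_to (cvgD (qcv v) (qcv w))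
   (_ : (fun n => b n.+1 (v + w) + K / 2 * `|v - w| ^+ 2 * 2 ^- n) @ \oo --> q (v + w))).
    rewrite -[X in _ --> X]addr0; apply: cvgD; last exact: cvg_half_pow.
    by have := qcv (v + w); rewrite -(cvg_shiftS (b ^~ (v + w))).
  by apply: nearW => n; exact: dyadic_quotientD.
have q0 : q 0 = 0.
  have b0 : b ^~ 0 @ \oo --> (0 : R).
    by under eq_fun do rewrite dyadic_quotient0; exact: cvg_cst.
  exact: (cvg_unique _ (qcv 0) b0).
have q2 v : q (v *+ 2) = 2 * q v.
  have b1 : (fun n => b n.+1 (v *+ 2)) @ \oo --> q (v *+ 2).
    by have := qcv (v *+ 2); rewrite -(cvg_shiftS (b ^~ (v *+ 2))).
  have b2 : (fun n => b n.+1 (v *+ 2)) @ \oo --> 2 * q v.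
    by under eq_fun do rewrite dyadic_quotient_double; apply: cvgMr.
  exact: (cvg_unique _ b1 b2).
have qMge n v : n%:R * q v <= q (v *+ n).
  elim: n => [|n IH]; first by rewrite mulr0n q0 mul0r.
  by rewrite (mulrSr v); apply: (le_trans _ (qD _ _)); rewrite -natr1; lra.
have qM2 n v : q (v *+ 2 ^ n) = (2 ^ n)%:R * q v.
  elim: n => [|n IH]; first by rewrite expn0 mulr1n mul1r.
  by rewrite expnSr mulrnA q2 IH natrM; ring.
have sq : subadditive_natmul (fun v => - q v).
  split=> [u v|n v]; first by have := qD u v; lra.
  (* Homogeneity is exact at powers of two. Splitting [2^n v] into [n v] and [(2^n - n) v], with the
     second part bounded below by [qMge], carries the upper bound over to [n v]. *)
  have n2 : (n <= 2 ^ n)%N by apply/ltnW/ltn_expl.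
  have := qD (v *+ n) (v *+ (2 ^ n - n)).
  rewrite -mulrnDr subnKC// qM2; have := qMge (2 ^ n - n)%N v.
  by rewrite natrB//; lra.
have [L [LD Lq]] := additive_minorant sq.
have LN v : L (- v) = - L v.
  have L0 : L 0 = 0 by have := LD 0 0; rewrite addr0; lra.
  by have := LD v (- v); rewrite subrr L0; lra.
have LC v : `|- L v| <= C * `|v|.
  have [_ _] := qP v; have [_ _] := qP (- v); rewrite normrN !ler_norml.
  move=> /andP[h1 _] /andP[h2 _]; have := Lq v; have := Lq (- v); rewrite LN; lra.
exists (fun v => - L v); split => //.
  by apply: (additive_bounded_scalar _ LC) => u v; rewrite LD opprD.
by move=> v; have [_ + _] := qP v; have := Lq v; lra.
Qed.

End supergradient.

(** * One-step bounds for a smooth function *)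

Section smooth2_step.
Variables (R : realType) (X : normedModType R).

Definition bounded_scalar (L : X -> R) :=
  scalar L /\ exists C, forall v, `|L v| <= C * `|v|.

Lemma bounded_scalarZ (k : R) L : bounded_scalar L -> bounded_scalar (fun v => k * L v).
Proof.
move=> [Ls [C LC]]; split; first by move=> a u v; rewrite Ls; ring.
exists (`|k| * C) => v; rewrite normrM -mulrA; exact: ler_wpM2l.
Qed.

Variables (Psi : X -> R) (D : R).
Hypothesis Psi_smooth : smooth2 D Psi.

Lemma smooth2_supergradient x : exists L : X -> R,
  [/\ scalar L, (forall v, `|L v| <= 2 * `|Psi x| * `|v|) &
    forall v, Psi (x + v) ^+ 2 <= Psi x ^+ 2 + L v + D ^+ 2 * `|v| ^+ 2].
Proof.
have [_ _ lip sm] := Psi_smooth.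
apply: (@supergradient _ _ (fun y => Psi y ^+ 2) x (D ^+ 2) (2 * `|Psi x|) 1).
  by move=> y v; exact: sm.
move=> v /=; rewrite mul1r subr_sqr normrM.
have h := lip x v; rewrite [leRHS](_ : _ = `|v| * (2 * `|Psi x| + `|v|)); last by ring.
apply: ler_pM => //.
rewrite (_ : Psi (x + v) + Psi x = 2 * Psi x + (Psi (x + v) - Psi x)); last by ring.
by apply: (le_trans (ler_normD _ _)); rewrite normrM ger0_norm// lerD2l.
Qed.

Let Dstar := Num.max 1 D.

Lemma max1r_ge1 : 1 <= Dstar. Proof. by rewrite le_max lexx. Qed.

Lemma sqr_le_max1r : D ^+ 2 <= Dstar ^+ 2.
Proof.
have [D0 _ _ _] := Psi_smooth.
by rewrite lerXn2r ?nnegrE ?(ltW D0)// ?le_max ?lexx ?orbT// ler01.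
Qed.

(** [coshR_affine_bound] is used at the fixed scale [b = lam Dstar c]: [Dstar >= 1] keeps the linear
    term within [2 p b], and [Dstar >= D] covers the quadratic term. *)
Lemma coshR_smooth2_bounded (lam c : R) x : 0 <= lam ->
  exists L, bounded_scalar L /\ forall v, `|v| <= c ->
    coshR (lam * Psi (x + v)) <=
    coshR (lam * Psi x) * expR (lam ^+ 2 * Dstar ^+ 2 * c ^+ 2 / 2) + L v.
Proof.
move=> lam0; have [L [Ls LC Lq]] := smooth2_supergradient x.
have Lb : bounded_scalar L by split => //; eexists; exact: LC.
pose p := lam * `|Psi x|; pose b := lam * (Dstar * c).
exists (fun v => (sinhR p * sinhR b / (2 * p * b) * lam ^+ 2) * L v).
split; first exact: bounded_scalarZ.
move=> v vc; have c0 : 0 <= c by exact: le_trans vc.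
have D1 := max1r_ge1.
have D0 : 0 <= Dstar by exact: le_trans D1.
have p0 : 0 <= p by rewrite mulr_ge0.
have b0 : 0 <= b by rewrite !mulr_ge0.
have vDc : `|v| <= Dstar * c by rewrite -[leLHS]mul1r ler_pM.
have -> : coshR (lam * Psi x) = coshR p by rewrite -coshR_norm normrM ger0_norm.
apply: (le_trans (@coshR_affine_bound _ p b (lam ^+ 2 * L v) _ p0 b0 _ _)).
- rewrite normrM ger0_norm ?sqr_ge0//.
  apply: (@le_trans _ _ (lam ^+ 2 * (2 * `|Psi x| * (Dstar * c)))).
    rewrite ler_wpM2l ?sqr_ge0//; apply: (le_trans (LC v)).
    by apply: ler_wpM2l => //; rewrite mulr_ge0.
  by rewrite le_eqVlt /p /b; apply/orP; left; apply/eqP; ring.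
- rewrite !exprMn -mulrDr -mulrDr ler_wpM2l ?sqr_ge0//.
  rewrite real_normK ?num_real//; apply: (le_trans (Lq v)); rewrite lerD2l.
  by rewrite ler_pM ?sqr_ge0 ?sqr_le_max1r// lerXn2r ?nnegrE.
- rewrite lerD//; last by rewrite le_eqVlt; apply/orP; left; apply/eqP; ring.
  rewrite ler_wpM2l ?(ltW (coshR_gt0 _))//; apply: (le_trans (coshR_le_expR_sqr _)).
  by rewrite ler_expR /b !exprMn !mulrA.
Qed.

(** Here the scale [a = lam |v|] follows the increment, so that [|v|^2] survives for the conditional
    variance. The coefficient of [L v] still depends only on [x]; the Lipschitz bound supplies the
    constraint [|z| <= p + a]. *)
Lemma coshR_smooth2_quadratic (lam c : R) x : 0 <= lam -> 0 < c ->
  exists L, bounded_scalar L /\ forall v, `|v| <= c ->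
    coshR (lam * Psi (x + v)) <=
    coshR (lam * Psi x) *
      (1 + Dstar ^+ 2 * ((expR (lam * c) - 1 - lam * c) / c ^+ 2) * `|v| ^+ 2) + L v.
Proof.
move=> lam0 c0; have [L [Ls LC Lq]] := smooth2_supergradient x.
have Lb : bounded_scalar L by split => //; eexists; exact: LC.
pose p := lam * `|Psi x|.
exists (fun v => (sinhR p / (2 * p) * lam ^+ 2) * L v).
split; first exact: bounded_scalarZ.
move=> v vc; have D1 := max1r_ge1.
have [_ _ lip _] := Psi_smooth.
have p0 : 0 <= p by rewrite mulr_ge0.
have a0 : 0 <= lam * `|v| by rewrite mulr_ge0.
have -> : coshR (lam * Psi x) = coshR p by rewrite -coshR_norm normrM ger0_norm.
apply: (le_trans (@coshR_quadratic_bound _ p (lam * `|v|) (lam ^+ 2 * L v)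
  (Dstar ^+ 2) _ p0 a0 _ _ _ _)).
- rewrite normrM ger0_norm ?sqr_ge0//.
  apply: (@le_trans _ _ (lam ^+ 2 * (2 * `|Psi x| * `|v|))).
    by rewrite ler_wpM2l ?sqr_ge0//; exact: LC.
  by rewrite le_eqVlt /p; apply/orP; left; apply/eqP; ring.
- by rewrite exprn_ege1.
- rewrite !exprMn (mulrCA (Dstar ^+ 2)) -mulrDr -mulrDr ler_wpM2l ?sqr_ge0//.
  rewrite real_normK ?num_real//; apply: (le_trans (Lq v)); rewrite lerD2l.
  by rewrite ler_wpM2r ?sqr_ge0 ?sqr_le_max1r.
- rewrite normrM ger0_norm// -mulrDr ler_wpM2l//.
  have := lip x v; have := ler_normD (Psi (x + v) - Psi x) (Psi x).
  by rewrite subrK; lra.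
- set E := expR (lam * `|v|) - 1 - _.
  set E' := expR (lam * c) - 1 - _.
  have EE : E <= E' / c ^+ 2 * `|v| ^+ 2.
    have [l0|ln0] := eqVneq lam 0.
      by rewrite /E /E' l0 !mul0r expR0 subrr subr0 !mul0r.
    have l0 : 0 < lam ^+ 2 by rewrite exprn_gt0// lt_neqAle eq_sym ln0.
    have := expR_tail2_mono a0 (ler_wpM2l lam0 vc).
    rewrite !exprMn -/E -/E' => H.
    by rewrite mulrAC ler_pdivlMr ?exprn_gt0// -(ler_pM2l l0) (mulrCA _ E) (mulrCA _ E').
  have C0 := coshR_gt0 p.
  have : Dstar ^+ 2 * E * coshR p <= Dstar ^+ 2 * (E' / c ^+ 2 * `|v| ^+ 2) * coshR p.
    by apply: ler_wpM2r; [exact: ltW|apply: ler_wpM2l EE; exact: sqr_ge0].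
  lra.
Qed.

End smooth2_step.

(** * Borel measurability and Bochner integrals *)

Section borel.

Lemma borel_preimage_continuous (X Y : topologicalType) (h : X -> Y) (B : set Y) :
  continuous h -> <<s open >> B -> <<s open >> (h @^-1` B).
Proof.
move=> /continuousP ch; apply: (@smallest_sub _ _ _ [set B | <<s open >> (h @^-1` B)]).
  split => /=.
  - by rewrite preimage_set0; exact: sigma_algebra0.
  - move=> A hA; rewrite setTD preimage_setC -setTD; exact: sigma_algebraCD.
  - by move=> A hA; rewrite preimage_bigcup; exact: sigma_algebra_bigcup.
by move=> A oA; apply: sub_sigma_algebra; exact: ch.
Qed.

Lemma borel_measurable_comp (T : Type) (X Y : topologicalType) (G : set (set T))
  (h : X -> Y) (f : T -> X) :
  continuous h -> borel_measurable G f -> borel_measurable G (h \o f).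
Proof. by move=> ch bf B sB; exact: (bf (h @^-1` B) (borel_preimage_continuous ch sB)). Qed.

Lemma measurable_sigma_open (R : realType) (B : set R) :
  measurable B -> <<s open >> B.
Proof.
move=> mB; have : (@RGenOpens.G R).-sigma.-measurable B by rewrite -RGenOpens.measurableE.
apply: smallest_sub; first exact: smallest_sigma_algebra.
by move=> _ [x [y ->]]; apply: sub_sigma_algebra; exact: interval_open.
Qed.

Lemma sigma_open_measurable (R : realType) (B : set R) :
  <<s open >> B -> measurable B.
Proof.
apply: smallest_sub; last by move=> A; exact: open_measurable.
split; [exact: measurable0|by move=> A mA; exact: measurableD|].
by move=> A mA; exact: bigcupT_measurable.
Qed.

Lemma borel_measurable_fun d (T : measurableType d) (R : realType) (f : T -> R) :
  borel_measurable measurable f -> measurable_fun setT f.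
Proof. by move=> bf _ B mB; rewrite setTI; apply: bf; exact: measurable_sigma_open. Qed.

Lemma borel_measurable_subset (T : Type) (X : topologicalType) (G G' : set (set T))
  (f : T -> X) : G `<=` G' -> borel_measurable G f -> borel_measurable G' f.
Proof. by move=> GG' bf B sB; apply: GG'; exact: bf. Qed.

Lemma borel_measurable_sigmaP d (T : measurableType d) (R : realType)
  (G : set (set T)) (f : T -> R) : sigma_algebra setT G ->
  borel_measurable G f <->
  measurable_fun [set: g_sigma_algebraType G] (f : g_sigma_algebraType G -> R).
Proof.
move=> sG; split.
  move=> bf _ B mB; rewrite setTI; apply: sub_sigma_algebra.
  by apply: bf; exact: measurable_sigma_open.
move=> mf B /sigma_open_measurable mB; rewrite -(sigma_algebra_id sG).
by have := mf measurableT B mB; rewrite setTI.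
Qed.

Lemma lipschitz_continuous_real (R : realType) (X : normedModType R) (f : X -> R) (C : R) :
  (forall u v, `|f u - f v| <= C * `|u - v|) -> continuous f.
Proof.
move=> fC x; apply/cvgrPdist_le => e e0.
have K0 : 0 < `|C| + 1 by rewrite ltr_wpDl.
near=> y; apply: (le_trans (fC x y)).
apply: (@le_trans _ _ ((`|C| + 1) * `|x - y|)).
  by rewrite ler_wpM2r//; have := ler_norm C; lra.
rewrite mulrC -ler_pdivlMr//.
near: y; apply: cvgr_dist_le => //; by rewrite divr_gt0.
Unshelve. all: by end_near. Qed.

Lemma scalarB (R : realType) (X : lmodType R) (L : X -> R) u v :
  scalar L -> L (u - v) = L u - L v.
Proof. by move=> Ls; rewrite -scaleN1r addrC Ls mulN1r addrC. Qed.

Lemma bounded_scalar_continuous (R : realType) (X : normedModType R) (L : X -> R) :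
  bounded_scalar L -> continuous L.
Proof.
move=> [Ls [C LC]]; apply: (@lipschitz_continuous_real _ _ _ C) => u v.
rewrite -scalarB//; exact: LC.
Qed.

End borel.

Section bochner.
Context d (T : measurableType d) (R : realType) (P : probability T R)
  (X : normedModType R).
Implicit Types (A B : set T) (f : T -> X) (L : X -> R) (s : seq (set T * X)).

(** A nonnegative integral is a supremum over simple functions below the integrand, so monotonicity
    holds for arbitrary functions, in particular for the error [|f - simple_eval (s n)|] in the
    Bochner integral. *)
Lemma ge0_integral_mono (D : set T) (f g : T -> \bar R) :
  (forall x, D x -> (0 <= f x)%E) -> (forall x, D x -> (f x <= g x)%E) ->
  (\int[P]_(x in D) f x <= \int[P]_(x in D) g x)%E.
Proof.
move=> f0 fg; have g0 x : D x -> (0 <= g x)%E by move=> Dx; exact: le_trans (f0 x Dx) (fg x Dx).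
rewrite !ge0_integralE//; apply: le_ereal_sup => _ [h hf <-]; exists h => //= x.
by apply: (le_trans (hf x)); exact: lee_restrict.
Qed.

Lemma cvg0_near_lt (u : nat -> \bar R) (r : R) :
  u @ \oo --> 0%E -> 0 < r -> \forall n \near \oo, (u n < r%:E)%E.
Proof.
move=> u0 r0; apply: (u0 [set x | (x < r%:E)%E]); apply: open_nbhs_nbhs.
by split; [exact: open_ereal_lt_ereal|rewrite /= lte_fin].
Qed.

Lemma scalar0 L : scalar L -> L 0 = 0.
Proof. by move=> Ls; rewrite -(subrr 0) scalarB// subrr. Qed.

Lemma scalar_simple_eval_cons L p s w : scalar L ->
  L (simple_eval (p :: s) w) = (\1_(p.1) w * L p.2) + L (simple_eval s w).
Proof. by move=> Ls; rewrite /simple_eval big_cons Ls. Qed.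

Lemma integral_simple_functional A s L : measurable A ->
  (forall p, p \in s -> measurable p.1) -> scalar L ->
  P.-integrable A (fun w => (L (simple_eval s w))%:E) /\
  (\int[P]_(w in A) (L (simple_eval s w))%:E = (L (simple_integral P A s))%:E)%E.
Proof.
move=> mA + Ls; elim: s => [_|p s IH ms].
  rewrite /simple_integral !big_nil scalar0//.
  under eq_fun do rewrite /simple_eval big_nil scalar0//.
  split; first exact: integrable0.
  by rewrite integral0.
have [|iI Is] := IH; first by move=> q qs; apply: ms; rewrite inE qs orbT.
have mp : measurable p.1 by apply: ms; rewrite mem_head.
have i1 : P.-integrable A (fun w => (\1_(p.1) w)%:E).
  by apply: integrableS (integrable_indic P mp).
have i2 : P.-integrable A (fun w => ((L p.2)%:E * (\1_(p.1) w)%:E)%E).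
  exact: integrableZl.
have E w : (L (simple_eval (p :: s) w))%:E =
    ((L p.2)%:E * (\1_(p.1) w)%:E + (L (simple_eval s w))%:E)%E.
  by rewrite scalar_simple_eval_cons// -EFinM -EFinD mulrC.
under eq_fun do rewrite E.
split; first exact: integrableD.
rewrite integralD// Is integralZl// integral_indic//.
rewrite /simple_integral big_cons Ls EFinD EFinM fineK; last first.
  by apply: fin_num_measure; exact: measurableI.
by rewrite muleC (setIC p.1).
Qed.

(** [L] maps the approximating simple functions to scalar ones converging in L^1 to [L \o f], and
    both sides pass to the limit. Vector-valued integrals are used later only through this scalar
    identity. *)
Lemma bochner_functional A f v L : measurable A ->
  is_bochner_integral P A f v -> bounded_scalar L ->
  P.-integrable A (fun w => (L (f w))%:E) /\
  (\int[P]_(w in A) (L (f w))%:E = (L v)%:E)%E.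
Proof.
move=> mA [bf [s [ms s0 sv]]] Lb; have [Ls [C LC]] := Lb.
have cL := bounded_scalar_continuous Lb.
have mf : measurable_fun A (fun w => (L (f w))%:E).
  apply/measurable_EFinP; apply: (@measurable_funS _ _ _ _ setT) => //.
  by apply: borel_measurable_fun; exact: borel_measurable_comp bf.
pose K := `|C| + 1; have K0 : 0 < K by rewrite /K ltr_wpDl.
have LK u : `|L u| <= K * `|u|.
  by apply: (le_trans (LC u)); rewrite ler_wpM2r// /K; have := ler_norm C; lra.
pose S n w := L (simple_eval (s n) w).
have iS n : P.-integrable A (fun w => (S n w)%:E).
  by have [] := integral_simple_functional mA (ms n) Ls.
have IS n : (\int[P]_(w in A) (S n w)%:E = (L (simple_integral P A (s n)))%:E)%E.
  by have [] := integral_simple_functional mA (ms n) Ls.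
pose e n := (\int[P]_(w in A) (`|f w - simple_eval (s n) w|)%:E)%E.
have mD n : measurable_fun A (fun w => ((L (f w))%:E - (S n w)%:E)%E).
  by apply: emeasurable_funB => //; exact: measurable_int (iS n).
have le_e n : (\int[P]_(w in A) `|(L (f w))%:E - (S n w)%:E| <= K%:E * e n)%E.
  rewrite -lee_pdivrMl// -ge0_integralZl_EFin ?invr_ge0 ?(ltW K0)//; last first.
    by apply: measurableT_comp => //; exact: measurable_abse.
  apply: ge0_integral_mono => w Aw; first by rewrite mule_ge0// lee_fin invr_ge0 ltW.
  rewrite -EFinB abse_EFin -EFinM lee_fin ler_pdivrMl// /S -scalarB//.
have e_fin : \forall n \near \oo, (e n < 1)%E.
  by apply: cvg0_near_lt s0 _; exact: ltr01.
have [N _ eN] := e_fin.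
have iD n : (N <= n)%N -> P.-integrable A (fun w => ((L (f w))%:E - (S n w)%:E)%E).
  move=> Nn; apply/integrableP; split => //; apply: (le_lt_trans (le_e n)).
  apply: (@lt_trans _ _ (K%:E * 1)%E); first by rewrite lte_pmul2l ?lte_fin//; exact: eN.
  by rewrite mule1 ltry.
have iL : P.-integrable A (fun w => (L (f w))%:E).
  have := integrableD mA (iD N (leqnn N)) (iS N).
  by apply: eq_integrable => // w _; rewrite subeK.
split => //.
have fL : (\int[P]_(w in A) (L (f w))%:E)%E \is a fin_num by exact: integrable_fin_num.
rewrite -(fineK fL); congr EFin; set I := fine _.
apply/eqP; rewrite -subr_eq0 -normr_le0; apply/ler_addgt0Pr => r r0; rewrite add0r.
have r2 : 0 < r / 2 by rewrite divr_gt0.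
have near1 : \forall n \near \oo, (e n < (r / 2 / K)%:E)%E.
  by apply: cvg0_near_lt s0 _; rewrite divr_gt0.
have near2 : \forall n \near \oo, `|L v - L (simple_integral P A (s n))| <= r / 2.
  by apply: cvgr_dist_le => //; apply: continuous_cvg => //; exact: cL.
near \oo => n.
have h1 : (e n < (r / 2 / K)%:E)%E by near: n.
have h2 : `|L v - L (simple_integral P A (s n))| <= r / 2 by near: n.
have Nn : (N <= n)%N by near: n; exact: nbhs_infty_ge.
have h3 : `|I - L (simple_integral P A (s n))| <= r / 2.
  rewrite -lee_fin -abse_EFin EFinB -IS /I fineK// -integralB//.
  apply: (le_trans (le_abse_integral _ mA (mD n))); apply: (le_trans (le_e n)).
  by rewrite -lee_pdivlMl// muleC -EFinM; exact: ltW.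
rewrite (_ : I - L v = (I - L (simple_integral P A (s n))) -
  (L v - L (simple_integral P A (s n)))); last by ring.
by apply: (le_trans (ler_normB _ _)); lra.
Unshelve. all: by end_near. Qed.

End bochner.

(** * Countable partitions and Ville's inequality *)

Section sigma_algebra_closure.
Context d (T : measurableType d) (G : set (set T)).
Hypothesis sG : sigma_algebra setT G.

Lemma sigma_algebra_setI A B : G A -> G B -> G (A `&` B).
Proof.
by rewrite -(measurable_g_measurableTypeE sG) => mA mB; exact: measurableI.
Qed.

Lemma sigma_algebra_setC A : G A -> G (~` A).
Proof.
by rewrite -(measurable_g_measurableTypeE sG) => mA; exact: measurableC.
Qed.

Lemma sigma_algebra_setT : G setT.
Proof. by rewrite -(measurable_g_measurableTypeE sG); exact: measurableT. Qed.

Lemma sigma_algebra_setU A B : G A -> G B -> G (A `|` B).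
Proof.
by rewrite -(measurable_g_measurableTypeE sG) => mA mB; exact: measurableU.
Qed.

Lemma sigma_algebra_seqDU (B : nat -> set T) n : (forall n, G (B n)) -> G (seqDU B n).
Proof.
rewrite -(measurable_g_measurableTypeE sG) => mB.
exact: (@seqDU_measurable _ (g_sigma_algebraType G)).
Qed.

End sigma_algebra_closure.

Section cover.
Context d (T : measurableType d) (R : realType) (P : probability T R).
Variable G : set (set T).
Hypotheses (sG : sigma_algebra setT G) (GM : G `<=` measurable).

(** The cover is made disjoint within [G] and the pieces are summed. The local inequality is asked
    on every [G]-subset of a cell so that a second cover can refine the first. *)
Lemma ge0_integral_cover_le (B : nat -> set T) (f g : T -> \bar R) :
  (forall n, G (B n)) -> \bigcup_n B n = setT ->
  (forall w, (0 <= f w)%E) -> (forall w, (0 <= g w)%E) ->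
  measurable_fun setT f -> measurable_fun setT g ->
  forall A, G A ->
  (forall n A', G A' -> A' `<=` A -> A' `<=` B n ->
    (\int[P]_(w in A') f w <= \int[P]_(w in A') g w)%E) ->
  (\int[P]_(w in A) f w <= \int[P]_(w in A) g w)%E.
Proof.
move=> GB Bcov f0 g0 mf mg A GA fgB.
have GF n : G (A `&` seqDU B n).
  by apply: sigma_algebra_setI => //; exact: sigma_algebra_seqDU.
have AE : A = \bigcup_n (A `&` seqDU B n).
  by rewrite -setI_bigcupr -seqDU_bigcup_eq Bcov setIT.
have tF : trivIset setT (fun n => A `&` seqDU B n).
  by apply: trivIset_setIl; exact: trivIset_seqDU.
rewrite AE !ge0_integral_bigcup//; last 4 first.
- by move=> n; exact: GM (GF n).
- exact: measurable_funTS.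
- by move=> n; exact: GM (GF n).
- exact: measurable_funTS.
apply: lee_nneseries => n *; first exact: integral_ge0.
by apply: (fgB n) => // w [_]; exact: subset_seqDU.
Qed.

Lemma dense_cover (X : normedModType R) (y : T -> X) (e : R) : separable X ->
  borel_measurable G y -> 0 < e ->
  exists x : nat -> X, (forall n, G [set w | `|y w - x n| < e]) /\
    \bigcup_n [set w | `|y w - x n| < e] = setT.
Proof.
move=> [D [cD dD]] my e0.
have [phi phi_inj] := countable_injP _ cD.
(* Indices that code no point of [D] get the default centre 0; their balls are in [G] as well and do
   not affect the covering. *)
pose x n := xget 0 [set u | D u /\ phi u = n].
exists x; split.
  move=> n; have -> : [set w | `|y w - x n| < e] = y @^-1` (ball (x n) e).
    by apply/seteqP; split => w /=; rewrite -ball_normE/= distrC.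
  by apply: my; apply: sub_sigma_algebra; exact: ball_open.
apply/seteqP; split => // w _.
have [||u [yu Du]] := dD (ball (y w) e).
- by exists (y w); exact: ballxx.
- exact: ball_open.
exists (phi u) => //=.
have [Dx phix] : D (x (phi u)) /\ phi (x (phi u)) = phi u.
  by apply: (@xgetPex _ 0 [set v | D v /\ phi v = phi u]); exists u.
have <- : u = x (phi u) by apply: phi_inj; rewrite ?inE.
by move: yu; rewrite -ball_normE.
Qed.

Lemma slice_cover (W : T -> R) (e : R) : borel_measurable G W -> 0 < e ->
  exists s : nat -> R, (forall n, G [set w | s n <= W w <= s n + e]) /\
    \bigcup_n [set w | s n <= W w <= s n + e] = setT.
Proof.
move=> mW e0; pose z (n : nat) : int := odflt 0 (unpickle n).
exists (fun n => (z n)%:~R * e); split.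
  move=> n; have -> : [set w | (z n)%:~R * e <= W w <= (z n)%:~R * e + e] =
      W @^-1` `[(z n)%:~R * e, (z n)%:~R * e + e]%classic.
    by apply/seteqP; split => w /=; rewrite in_itv.
  by apply: mW; exact: measurable_sigma_open.
apply/seteqP; split => // w _; exists (pickle (Num.floor (W w / e))) => //=.
rewrite /z pickleK/= -ler_pdivlMr// floor_le_tmp/=.
rewrite -[X in _ + X]mul1r -mulrDl -ler_pdivrMr// -intrD1.
by apply/ltW/floorD1_gt.
Qed.

End cover.

Section ereal_expR.
Variable R : realType.

Lemma lee_expR_limit (a b : \bar R) (K : R) : 0 < K -> (0 <= b)%E ->
  (forall e, 0 < e -> (a <= (expR (K * e))%:E * b)%E) -> (a <= b)%E.
Proof.
move=> K0 b0 H; case: b b0 H => [b|_ _|//]; last by rewrite leey.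
rewrite lee_fin => b0 H; apply/lee_addgt0Pr => e e0.
have q0 : 0 < e / (b + 1) by rewrite divr_gt0// ltr_wpDl.
have l0 : 0 < ln (1 + e / (b + 1)) by rewrite ln_gt0// ltrDl.
(* With this parameter the factor is [1 + e / (b + 1)], which raises [b] by at most [e]. *)
apply: (le_trans (H (ln (1 + e / (b + 1)) / K) _)); first by rewrite divr_gt0.
rewrite mulrC divfK ?gt_eqF// lnK ?posrE; last by rewrite addr_gt0.
rewrite -EFinM -EFinD lee_fin mulrDl mul1r lerD2l mulrAC ler_pdivrMr ?ltr_wpDl//.
by rewrite ler_pM2l//; lra.
Qed.

End ereal_expR.

Section ville.
Context d (T : measurableType d) (R : realType) (P : probability T R).
Variables (F : nat -> set (set T)) (M : nat -> T -> R) (b : R).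
Hypotheses (fF : filtration F) (M0 : forall t w, 0 <= M t w)
  (mM : forall t, borel_measurable (F t) (M t))
  (supM : forall t A, F t A ->
    (\int[P]_(w in A) (M t.+1 w)%:E <= \int[P]_(w in A) (M t w)%:E)%E)
  (b0 : 0 < b).

Let hit n := [set w | exists2 t, (t <= n)%N & b <= M t w].
Let E t := [set w | b <= M t w].

Let FE t : F t (E t).
Proof.
have -> : E t = M t @^-1` `[b, +oo[%classic.
  by apply/seteqP; split => w /=; rewrite in_itv/= andbT.
by apply: mM; exact: measurable_sigma_open.
Qed.

Let hitS n : hit n.+1 = hit n `|` E n.+1.
Proof.
apply/seteqP; split => w.
  move=> [t]; rewrite leq_eqVlt ltnS => /orP[/eqP ->|tn] H; first by right.
  by left; exists t.
by move=> [[t tn H]|H]; [exists t => //; exact: leqW|exists n.+1].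
Qed.

Let hit0 : hit 0 = E 0%N.
Proof.
by apply/seteqP; split => w; [move=> [t]; rewrite leqn0 => /eqP ->|exists 0%N].
Qed.

Let Fhit n : F n (hit n).
Proof.
have [sF _ incF] := fF.
elim: n => [|n IH]; first by rewrite hit0.
by rewrite hitS; apply: sigma_algebra_setU => //; exact: (incF n).
Qed.

Let FM t A : F t A -> measurable A. Proof. by have [_ + _] := fF; exact. Qed.

Let meM t : measurable_fun setT (EFin \o M t).
Proof.
apply/measurable_EFinP; apply: borel_measurable_fun.
by apply: borel_measurable_subset (mM t); exact: FM.
Qed.

Let hit_split n A : F n A ->
  (b%:E * P (A `&` E n) + \int[P]_(w in A `&` ~` E n) (M n w)%:E
    <= \int[P]_(w in A) (M n w)%:E)%E.
Proof.
move=> FA; have mA := FM FA; have mE := FM (FE n).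
have mAE : measurable (A `&` E n) by exact: measurableI.
have mAC : measurable (A `&` ~` E n) by apply: measurableI => //; exact: measurableC.
rewrite [leRHS](_ : _ = \int[P]_(w in A `&` E n) (M n w)%:E +
    \int[P]_(w in A `&` ~` E n) (M n w)%:E)%E; last first.
  rewrite -ge0_integral_setU//.
  - by rewrite -setIUr setUv setIT.
  - by apply: measurable_funTS; exact: meM.
  - by move=> w _; rewrite lee_fin.
  - by apply/disj_setPS => w [[_ ?] [_ ?]].
apply: leeD => //; rewrite -integral_cst//.
apply: ge0_le_integral => //.
- by move=> w _; rewrite lee_fin ltW.
- by apply: measurable_funTS; exact: meM.
- by move=> w [_ ?]; rewrite lee_fin.
Qed.

(** The left side is the mean of the process stopped at level [b]: paths that have hit count [b],
    the others [M n]. The complement of [hit n] lies in [F n], so [supM] advances [M] there before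
    [E n.+1] is split off. *)
Let hit_bound n :
  (b%:E * P (hit n) + \int[P]_(w in ~` hit n) (M n w)%:E
    <= \int[P]_w (M 0 w)%:E)%E.
Proof.
have [sF _ incF] := fF.
elim: n => [|n IH].
  by have := hit_split (sigma_algebra_setT (sF 0%N)); rewrite !setTI hit0.
have FC : F n (~` hit n) by apply: sigma_algebra_setC.
apply: le_trans IH; have FC1 : F n.+1 (~` hit n) by apply: (incF n).
have H := le_trans (hit_split FC1) (supM FC).
have -> : ~` hit n.+1 = ~` hit n `&` ~` E n.+1 by rewrite hitS setCU.
have -> : P (hit n.+1) = (P (hit n) + P (~` hit n `&` E n.+1))%E.
  rewrite -measureU//.
  - by congr (P _); rewrite hitS setUIr setUv setTI.
  - exact: FM (Fhit n).
  - by apply: measurableI; [exact: FM FC|exact: FM (FE _)].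
  - by apply/seteqP; split => w // [? []].
rewrite ge0_muleDr// -addeA; exact: leeD2l.
Qed.

Lemma ville : (\int[P]_w (M 0 w)%:E <= 1)%E ->
  measurable [set w | exists t, b <= M t w] /\
  (P [set w | exists t, (b <= M t w)%R] <= (b^-1)%:E)%E.
Proof.
move=> M1.
have HE : [set w | exists t, b <= M t w] = \bigcup_n hit n.
  by apply/seteqP; split => w; [move=> [t]; exists t => //; exists t|move=> [n _ [t _]]; exists t].
have mh n : measurable (hit n) by exact: FM (Fhit n).
have mU : measurable (\bigcup_n hit n) by exact: bigcupT_measurable.
rewrite HE; split => //.
have nd : nondecreasing_seq hit.
  by move=> m n mn; apply/subsetPset => w [t tm H]; exists t => //; exact: leq_trans mn.
have cv := nondecreasing_cvg_mu (mu := P) mh mU nd.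
rewrite -(cvg_lim _ cv)//; apply: lime_le; first by apply/cvg_ex; eexists; exact: cv.
apply: nearW => n /=; rewrite -[leRHS]mule1 -lee_pdivrMl ?invr_gt0// invrK.
apply: le_trans M1; apply: le_trans (hit_bound n); apply: leeDl.
by apply: integral_ge0 => w _; rewrite lee_fin.
Qed.

End ville.

(** * The supermartingale *)

Lemma continuous_coshR (R : realType) : continuous (@coshR R).
Proof.
move=> x; rewrite /coshR; apply: cvgM; last exact: cvg_cst.
apply: cvgD; first exact: continuous_expR.
by apply: continuous_comp; [exact: opp_continuous|exact: continuous_expR].
Qed.

Section step.
Context d (T : measurableType d) (R : realType) (P : probability T R)
  (X : normedModType R).
Variables (G : set (set T)) (y y' : T -> X) (Psi : X -> R) (lam : R) (h U W : T -> R).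
Hypotheses (X_separable : separable X)
  (sG : sigma_algebra setT G) (GM : G `<=` measurable)
  (yy' : is_bochner_cond_exp P G y' y)
  (lip : forall u v, `|Psi u - Psi v| <= `|u - v|)
  (lam0 : 0 <= lam)
  (ih : P.-integrable setT (EFin \o h))
  (mU : borel_measurable G U) (mW : borel_measurable G W)
  (hU : forall A, G A ->
    (\int[P]_(w in A) (h w)%:E <= \int[P]_(w in A) (expR (U w))%:E)%E)
  (hPsi : forall x, exists L, bounded_scalar L /\
    {ae P, forall w, coshR (lam * Psi (x + (y' w - y w))) <=
      coshR (lam * Psi x) * h w + L (y' w - y w)}).

(** [W] stands for the compensator after the step and [U] for its increment, so [f2] is the process
    before the step. Both carry the same [G]-measurable factor [exp (- W)], which can be frozen on a
    cell. *)
Let f1 w := expR (- W w) * coshR (lam * Psi (y' w)).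
Let f2 w := expR (- W w) * (expR (U w) * coshR (lam * Psi (y w))).

Lemma measurable_coshR_comp (z : T -> X) : borel_measurable measurable z ->
  measurable_fun setT (fun w => coshR (lam * Psi (z w))).
Proof.
move=> mz; apply: borel_measurable_fun.
have cP : continuous Psi.
  by apply: (@lipschitz_continuous_real _ _ _ 1) => u v; rewrite mul1r.
apply: (@borel_measurable_comp _ _ _ _ (fun u => coshR (lam * Psi u)) z) => // u.
apply: (@continuous_comp _ _ _ (fun u => lam * Psi u) (@coshR R)).
  by apply: cvgMr; exact: cP.
exact: continuous_coshR.
Qed.

Let mGr (f : T -> R) : borel_measurable G f -> measurable_fun setT f.
Proof. by move=> mf; apply: borel_measurable_fun; exact: borel_measurable_subset mf. Qed.

Let my : borel_measurable measurable y.
Proof. by have [_ [v [+ _]] _ _] := yy'. Qed.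

Let my' : borel_measurable measurable y'.
Proof. by have [[v [+ _]] _ _ _] := yy'. Qed.

Let mf1 : measurable_fun setT f1.
Proof.
apply: measurable_funM; last exact: measurable_coshR_comp.
apply: measurableT_comp => //; apply: measurableT_comp => //; exact: mGr.
Qed.

Let meU : measurable_fun setT (fun w => expR (U w)).
Proof. by apply: measurableT_comp => //; exact: mGr. Qed.

Let mf2 : measurable_fun setT f2.
Proof.
apply: measurable_funM.
  apply: measurableT_comp => //; apply: measurableT_comp => //; exact: mGr.
by apply: measurable_funM => //; exact: measurable_coshR_comp.
Qed.

Let f10 w : 0 <= f1 w. Proof. by rewrite mulr_ge0 ?expR_ge0// ltW// coshR_gt0. Qed.
Let f20 w : 0 <= f2 w.
Proof. by rewrite !mulr_ge0 ?expR_ge0// ltW// coshR_gt0. Qed.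

(** Moving from [y] to [x] and back costs [exp (lam e)] twice, and replacing [W] by [s] costs
    [exp e]: together the exponent [(2 lam + 1) e]. *)
Let step_local (A : set T) (x : X) (s e : R) : G A -> 0 < e ->
  (forall w, A w -> `|y w - x| < e) -> (forall w, A w -> s <= W w <= s + e) ->
  (\int[P]_(w in A) (f1 w)%:E <=
   \int[P]_(w in A) ((expR ((2 * lam + 1) * e))%:E * (f2 w)%:E))%E.
Proof.
move=> GA e0 yx Ws; have mA := GM GA.
have [L [Lb hL]] := hPsi x; have [Ls _] := Lb.
pose C := coshR (lam * Psi x); have C0 : 0 < C by exact: coshR_gt0.
pose k := expR (- s + lam * e); have k0 : 0 < k by exact: expR_gt0.
have [_ _ _ /(_ A GA) [v [iy' iy]]] := yy'.
have [iLy' ILy'] := bochner_functional mA iy' Lb.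
have [iLy ILy] := bochner_functional mA iy Lb.
have ihA : P.-integrable A (EFin \o h) by exact: integrableS ih.
pose F2 w := k * (C * h w + (L (y' w) - L (y w))).
have i1 : P.-integrable A (fun w => (C%:E * (h w)%:E)%E) by exact: integrableZl.
have i2 : P.-integrable A (fun w => ((L (y' w))%:E - (L (y w))%:E)%E) by exact: integrableB.
have i3 : P.-integrable A (fun w => (C%:E * (h w)%:E + ((L (y' w))%:E - (L (y w))%:E))%E).
  exact: integrableD.
have F2E : (fun w => (F2 w)%:E) =
    (fun w => (k%:E * (C%:E * (h w)%:E + ((L (y' w))%:E - (L (y w))%:E)))%E).
  by apply/funext => w; rewrite /F2 EFinM EFinD EFinM EFinB.
have iF2 : P.-integrable A (fun w => (F2 w)%:E).
  by rewrite F2E; exact: integrableZl.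
(* [y'] and [y] have the same Bochner integral [v] over [A], so the linear term integrates to 0. *)
have IF2 : (\int[P]_(w in A) (F2 w)%:E = k%:E * (C%:E * \int[P]_(w in A) (h w)%:E))%E.
  rewrite F2E integralZl//; congr (_ * _)%E; rewrite integralD//.
  by rewrite integralZl// integralB// ILy ILy' subee// adde0.
have mF2 : measurable_fun A (fun w => (F2 w)%:E) by exact: measurable_int iF2.
have f1F2 : {ae P, forall w, A w -> f1 w <= F2 w}.
  apply: filterS hL => w hw Aw.
  have /andP[sW Wse] := Ws w Aw.
  rewrite /f1 /F2 -scalarB//; apply: (@le_trans _ _ (k * coshR (lam * Psi (x + (y' w - y w))))).
    rewrite /k expRD -mulrA; apply: ler_pM; rewrite ?expR_ge0 ?(ltW (coshR_gt0 _))//.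
      by rewrite ler_expR lerN2.
    apply: coshR_le_expRM; rewrite -mulrBr normrM ger0_norm// ler_wpM2l//.
    apply: (le_trans (lip _ _)); rewrite (_ : y' w - _ = y w - x); first exact/ltW/yx.
    by rewrite opprD opprB addrCA (addrC (y' w)) subrK addrC.
  by rewrite ler_wpM2l// ltW.
apply: (@le_trans _ _ (\int[P]_(w in A) (F2 w)%:E)%E).
  (* [F2] is known to be nonnegative only almost everywhere on [A]; [|F2|] has the same integral. *)
  rewrite (_ : (\int[P]_(w in A) (F2 w)%:E = \int[P]_(w in A) `|(F2 w)%:E|)%E); last first.
    apply: ae_eq_integral => //; first exact: measurableT_comp.
    apply: filterS f1F2 => w H Aw; rewrite gee0_abs// lee_fin.
    exact: le_trans (f10 w) (H Aw).
  apply: ae_ge0_le_integral => //.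
  - by move=> w _; rewrite lee_fin.
  - by apply: measurable_funTS; apply/measurable_EFinP.
  - exact: measurableT_comp.
  - apply: filterS f1F2 => w H Aw; rewrite abse_EFin lee_fin.
    exact: le_trans (H Aw) (ler_norm _).
rewrite IF2; apply: (@le_trans _ _ (k%:E * (C%:E * \int[P]_(w in A) (expR (U w))%:E))%E).
  by rewrite !lee_pmul2l// ?lte_fin//; exact: hU.
rewrite muleA -EFinM -ge0_integralZl_EFin//; last 2 first.
- by apply: measurable_funTS; apply/measurable_EFinP.
- by rewrite mulr_ge0 ?ltW.
apply: ge0_le_integral => //.
- by move=> w _; rewrite -EFinM lee_fin !mulr_ge0 ?expR_ge0// ltW.
- by apply: measurable_funTS; apply/measurable_EFinP; exact: measurable_funM.
- by apply: measurable_funTS; apply/measurable_EFinP; exact: measurable_funM.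
move=> w Aw; rewrite -!EFinM lee_fin /f2.
have /andP[sW Wse] := Ws w Aw.
rewrite [leRHS](_ : _ = (expR ((2 * lam + 1) * e) * expR (- W w) *
  coshR (lam * Psi (y w))) * expR (U w)); last by ring.
rewrite ler_wpM2r ?expR_ge0//.
apply: (@le_trans _ _ (k * (expR (lam * e) * coshR (lam * Psi (y w))))).
  rewrite ler_wpM2l ?(ltW k0)//; apply: coshR_le_expRM.
  rewrite -mulrBr normrM ger0_norm// ler_wpM2l//.
  by apply: (le_trans (lip _ _)); rewrite distrC; exact/ltW/yx.
rewrite mulrA ler_wpM2r ?(ltW (coshR_gt0 _))// /k -!expRD ler_expR.
by lra.
Qed.

(* [y] and [W] are replaced by constants on the cells of a countable partition
   into sets of [G]; there the supergradient at the constant can be integrated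
   against the martingale increment, so no measurable choice of supergradients
   is needed. *)
Lemma coshR_supermartingale_step A : G A ->
  (\int[P]_(w in A) (f1 w)%:E <= \int[P]_(w in A) (f2 w)%:E)%E.
Proof.
move=> GA; apply: (@lee_expR_limit _ _ _ (2 * lam + 1)).
- by rewrite ltr_wpDl// mulr_ge0.
- by apply: integral_ge0 => w _; rewrite lee_fin.
move=> e e0.
have [_ _ myG _] := yy'.
have [x [Gx xcov]] := dense_cover X_separable myG e0.
have [s [Gs scov]] := slice_cover mW e0.
rewrite -ge0_integralZl_EFin ?expR_ge0//; last 3 first.
- exact: GM.
- by move=> w _; rewrite lee_fin.
- by apply: measurable_funTS; apply/measurable_EFinP.
have p1 w : (0 <= (f1 w)%:E)%E by rewrite lee_fin.
have p2 w : (0 <= (expR ((2 * lam + 1) * e))%:E * (f2 w)%:E)%E.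
  by rewrite -EFinM lee_fin mulr_ge0 ?expR_ge0.
have m1 : measurable_fun setT (fun w => (f1 w)%:E) by apply/measurable_EFinP.
have m2 : measurable_fun setT (fun w => ((expR ((2 * lam + 1) * e))%:E * (f2 w)%:E)%E).
  by apply/measurable_EFinP; exact: measurable_funM.
apply: (ge0_integral_cover_le sG GM Gx xcov) => // n B GB _ Bx.
apply: (ge0_integral_cover_le sG GM Gs scov) => // m B' GB' B'B B's.
apply: (step_local (x := x n) (s := s m) GB' e0) => w B'w; last exact: B's.
exact/Bx/B'B.
Qed.

End step.

Section maximal_inequality.
Context d (T : measurableType d) (R : realType) (P : probability T R)
  (X : normedModType R).
Variables (F : nat -> set (set T)) (Y : nat -> T -> X) (Psi : X -> R) (lam : R)
  (W U h : nat -> T -> R).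
Hypotheses (X_separable : separable X) (fF : filtration F)
  (mart : martingale P F Y) (Y0 : forall w, Y 0%N w = 0)
  (Psi0 : Psi 0 = 0) (lip : forall u v, `|Psi u - Psi v| <= `|u - v|)
  (lam0 : 0 <= lam)
  (W0 : forall w, W 0%N w = 0) (WS : forall t w, W t.+1 w = W t w + U t w)
  (mU : forall t, borel_measurable (F t) (U t))
  (ih : forall t, P.-integrable setT (EFin \o h t))
  (hU : forall t A, F t A ->
    (\int[P]_(w in A) (h t w)%:E <= \int[P]_(w in A) (expR (U t w))%:E)%E)
  (hPsi : forall t x, exists L, bounded_scalar L /\
    {ae P, forall w, coshR (lam * Psi (x + (Y t.+1 w - Y t w))) <=
      coshR (lam * Psi x) * h t w + L (Y t.+1 w - Y t w)}).

Let sF t : sigma_algebra setT (F t). Proof. by have [+ _ _] := fF; exact. Qed.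

Let FM t : F t `<=` measurable. Proof. by have [_ + _] := fF; exact. Qed.

Let mYF t : borel_measurable (F t) (Y t). Proof. by have [+ _ _] := mart; exact. Qed.

Let cPsi : continuous Psi.
Proof. by apply: (@lipschitz_continuous_real _ _ _ 1) => u v; rewrite mul1r. Qed.

(** Cells of [F t] must fix [W t.+1] up to [e], so the compensator has to be predictable; it is,
    because [U t] is [F t]-measurable. *)
Let mWpred t : borel_measurable (F t) (W t) /\ borel_measurable (F t) (W t.+1).
Proof.
have inc s : F s `<=` F s.+1 by have [_ _ /(_ s s.+1 (leqnSn s))] := fF.
have WSf s : W s.+1 = W s \+ U s by apply/funext => w; rewrite WS.
elim: t => [|t [_ IH]].
  have mW0 : borel_measurable (F 0%N) (W 0%N).
    apply/borel_measurable_sigmaP => //.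
    by rewrite (_ : W 0%N = cst 0)//; apply/funext => w; rewrite W0.
  split => //; apply/borel_measurable_sigmaP => //; rewrite WSf.
  by apply: measurable_funD; apply/borel_measurable_sigmaP.
have mW1 : borel_measurable (F t.+1) (W t.+1) by apply: borel_measurable_subset IH.
split => //; apply/borel_measurable_sigmaP => //; rewrite WSf.
by apply: measurable_funD; apply/borel_measurable_sigmaP.
Qed.

Let M t w := expR (- W t w) * coshR (lam * Psi (Y t w)).

Let mM t : borel_measurable (F t) (M t).
Proof.
apply/borel_measurable_sigmaP => //; apply: measurable_funM.
  apply: measurableT_comp => //; apply: measurableT_comp => //.
  by apply/borel_measurable_sigmaP => //; have [] := mWpred t.
apply/borel_measurable_sigmaP => //.
apply: (@borel_measurable_comp _ _ _ _ (fun u => coshR (lam * Psi u)) (Y t)) => // u.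
apply: (@continuous_comp _ _ _ (fun u => lam * Psi u) (@coshR R)).
  by apply: cvgMr; exact: cPsi.
exact: continuous_coshR.
Qed.

Let supM t A : F t A ->
  (\int[P]_(w in A) (M t.+1 w)%:E <= \int[P]_(w in A) (M t w)%:E)%E.
Proof.
move=> FA; have [_ _ /(_ t) ce] := mart.
have := @coshR_supermartingale_step _ _ _ P _ (F t) (Y t) (Y t.+1) Psi lam (h t)
  (U t) (W t.+1) X_separable (sF t) (@FM t) ce lip lam0 (ih t) (mU t)
  (mWpred t).2 (@hU t) (hPsi t) A FA.
move=> H; apply: (le_trans H); rewrite le_eqVlt; apply/orP; left; apply/eqP.
apply: eq_integral => w _; congr EFin.
by rewrite mulrA -expRD /M; congr (expR _ * _); rewrite WS; ring.
Qed.

(** Ville's inequality at level [b]; the [2 * b] in the hypothesis on [thr] pays for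
    [cosh u >= e^u / 2]. *)
Lemma maximal_inequality (thr : nat -> T -> R) (b : R) : 0 < b ->
  (forall t, measurable_fun setT (thr t)) ->
  (forall t w, thr t w <= Psi (Y t w) ->
    2 * b <= expR (lam * Psi (Y t w) - W t w)) ->
  (P [set w | exists t, (Psi (Y t w) >= thr t w)%R] <= (b^-1)%:E)%E.
Proof.
move=> b0 mthr thrb.
have M0 t w : 0 <= M t w by rewrite mulr_ge0 ?expR_ge0// ltW// coshR_gt0.
have M1 : (\int[P]_w (M 0 w)%:E <= 1)%E.
  under eq_integral => w _ do
    rewrite /M W0 Y0 Psi0 mulr0 coshR0 oppr0 expR0 mulr1.
  by rewrite integral_cst// mul1e probability_le1.
have [mE] := ville fF M0 mM supM b0 M1.
apply: le_trans; apply: le_measure; rewrite ?inE//.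
  rewrite (_ : [set w | _] = \bigcup_t ((fun w => Psi (Y t w) - thr t w) @^-1` `[0, +oo[%classic)).
    apply: bigcupT_measurable => t; rewrite -[X in measurable X]setTI.
    have mf : measurable_fun setT (fun w => Psi (Y t w) - thr t w).
      apply: measurable_funB => //; apply: borel_measurable_fun.
      apply: borel_measurable_subset (@FM t) _.
      exact: (borel_measurable_comp cPsi (mYF t)).
    by apply: mf => //; exact: measurable_itv.
  apply/seteqP; split => w /=.
    by move=> [t H]; exists t => //=; rewrite in_itv/= andbT subr_ge0.
  by move=> [t _ /=]; rewrite in_itv/= andbT subr_ge0 => H; exists t.
move=> w /= [t /thrb H]; exists t; rewrite /M.
have := coshR_geV2 (lam * Psi (Y t w)).
rewrite -(ler_pM2l (expR_gt0 (- W t w))) => H2; apply: le_trans H2.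
by rewrite mulrA -expRD ler_pdivlMr// mulrC addrC.
Qed.

End maximal_inequality.

(** * The two boundary-crossing inequalities *)

Theorem corollary10 (d : measure_display) (T : measurableType d)
    (R : realType) (P : probability T R)
    (X : completeNormedModType R) (F : nat -> set (set T))
    (Y : nat -> T -> X) (Psi : X -> R) (D : R)
    (X_separable : separable X)
    (F_filtration : filtration F)
    (F0_trivial : F 0%N = [set set0; setT])
    (Y_martingale : martingale P F Y)
    (Y0 : forall w, Y 0%N w = 0)
    (Psi_smooth : smooth2 D Psi) :
  let Dstar := Num.max 1 D in
  (forall c : nat -> R,
     (forall t, (0 < t)%N -> {ae P, forall w, `|increment Y t w| <= c t}) ->
     let V := fun t : nat => \sum_(1 <= i < t.+1) c i ^+ 2 in
     forall x m : R, 0 < x -> 0 < m ->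
       (P [set w | exists t : nat,
             (Psi (Y t w) >= x + x / (2 * m) * (V t - m))%R]
        <= (2 * expR (- (x ^+ 2 / (2 * Dstar ^+ 2 * m))))%:E)%E)
  /\
  (forall c : R, 0 < c ->
     (forall t, (0 < t)%N -> {ae P, forall w, `|increment Y t w| <= c}) ->
     forall E : nat -> T -> R,
     (* E i is any version of the conditional expectation given F_(i-1) of the
        squared norm of the i-th increment *)
     (forall i, (0 < i)%N ->
        is_cond_exp P (F i.-1) (fun w => `|increment Y i w| ^+ 2) (E i)) ->
     let V := fun (t : nat) (w : T) => \sum_(1 <= i < t.+1) E i w in
     forall x m : R, 0 < x -> 0 < m ->
       (P [set w | exists t : nat,
             (Psi (Y t w) >=
              x + Dstar ^+ 2 * s_P c (x / (Dstar ^+ 2 * m)) * (V t w - m))%R]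
        <= (2 * expR (- (Dstar ^+ 2 * m *
                         psi_P_star c (x / (Dstar ^+ 2 * m)))))%:E)%E
       /\
       2 * expR (- (Dstar ^+ 2 * m * psi_P_star c (x / (Dstar ^+ 2 * m))))
         <= 2 * expR (- (x ^+ 2 / (2 * (Dstar ^+ 2 * m + c * x / 3))))).
Proof.
move=> Dstar.
have [D0 Psi0 lip sm] := Psi_smooth.
have lip' u v : `|Psi u - Psi v| <= `|u - v|.
  by have := lip v (u - v); rewrite (addrC v) subrK.
have D2 : 1 <= Dstar ^+ 2 by rewrite exprn_ege1// max1r_ge1.
have D2p : 0 < Dstar ^+ 2 by exact: lt_le_trans D2.
have Dn : Dstar != 0 by rewrite gt_eqF// (lt_le_trans ltr01)// max1r_ge1.
have [sF FM incF] := F_filtration.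
split.
- move=> c hc V x m x0 m0.
  have mn : m != 0 by rewrite gt_eqF.
  pose lam := x / (Dstar ^+ 2 * m).
  have lam0 : 0 <= lam by apply/ltW/divr_gt0 => //; exact: mulr_gt0.
  pose U (t : nat) (w : T) := lam ^+ 2 * Dstar ^+ 2 * c t.+1 ^+ 2 / 2.
  (* The bound is [b^-1] for the level [b] equal to half the exponential. *)
  have -> : 2 * expR (- (x ^+ 2 / (2 * Dstar ^+ 2 * m))) =
      (expR (x ^+ 2 / (2 * Dstar ^+ 2 * m)) / 2)^-1.
    by rewrite invf_div expRN.
  apply: (@maximal_inequality _ _ _ P _ F Y Psi lam
    (fun t _ => lam ^+ 2 * Dstar ^+ 2 * V t / 2) U (fun t w => expR (U t w))
    X_separable F_filtration Y_martingale Y0 Psi0 lip' lam0) => //.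
  + by move=> w; rewrite /V big_geq// mulr0 mul0r.
  + by move=> t w; rewrite /V big_nat_recr//= /U; ring.
  + by move=> t; apply/borel_measurable_sigmaP => //; exact: measurable_cst.
  + move=> t; exact: (@finite_measure_integrable_cst _ _ _ P setT
      (expR (lam ^+ 2 * Dstar ^+ 2 * c t.+1 ^+ 2 / 2)) measurableT).
  + move=> t y; have [L [Lb HL]] := coshR_smooth2_bounded Psi_smooth (c t.+1) y lam0.
    by exists L; split => //; apply: filterS (hc t.+1 isT) => w Hw; exact: HL.
  + by rewrite divr_gt0 ?expR_gt0.
  move=> t w H; rewrite mulrC divfK// ler_expR.
  have := ler_wpM2l lam0 H.
  have lamE : lam * (Dstar ^+ 2 * m) = x by rewrite divfK// gt_eqF// mulr_gt0.
  have -> : x ^+ 2 / (2 * Dstar ^+ 2 * m) = lam * x / 2.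
    by rewrite /lam; field; rewrite ?Dn ?mn ?cn ?ln0.
  have -> : lam ^+ 2 * Dstar ^+ 2 * V t / 2 = lam * (x / (2 * m)) * V t.
    by rewrite /lam; field; rewrite ?Dn ?mn ?cn ?ln0.
  have -> : lam * (x + x / (2 * m) * (V t - m)) = lam * x / 2 + lam * (x / (2 * m)) * V t.
    by field; rewrite ?Dn ?mn ?cn ?ln0.
  lra.
- move=> c c0 hc E hE V x m x0 m0.
  have mn : m != 0 by rewrite gt_eqF.
  have cn : c != 0 by rewrite gt_eqF.
  pose u := x / (Dstar ^+ 2 * m); rewrite -/u.
  have u0 : 0 < u by apply: divr_gt0 => //; exact: mulr_gt0.
  have cu0 : 0 < c * u by rewrite mulr_gt0.
  have cu1 : 0 < 1 + c * u by rewrite addr_gt0.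
  pose l := ln (1 + c * u).
  have l0 : 0 < l by rewrite ln_gt0// ltrDl.
  have ln0 : l != 0 by rewrite gt_eqF.
  pose lam := l / c.
  have lam0 : 0 <= lam by apply/ltW/divr_gt0.
  have lamc : lam * c = l by rewrite divfK ?gt_eqF.
  have uE : Dstar ^+ 2 * m * u = x by rewrite mulrC divfK// gt_eqF// mulr_gt0.
  pose kap := Dstar ^+ 2 * ((expR (lam * c) - 1 - lam * c) / c ^+ 2).
  have kapE : kap = Dstar ^+ 2 * ((c * u - l) / c ^+ 2).
    by rewrite /kap lamc lnK ?posrE//; congr (_ * (_ / _)); ring.
  have kap0 : 0 <= kap.
    apply: mulr_ge0; first exact: ltW.
    apply: divr_ge0; last exact: sqr_ge0.
    have := @expR_ge_deg2 _ (lam * c); rewrite lamc => /(_ (ltW l0)).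
    by apply: le_trans; rewrite divr_ge0 ?sqr_ge0.
  split; last first.
    rewrite ler_pM2l// ler_expR lerN2.
    (* [bennett_bernstein] at [c u], scaled by [Dstar^2 m / c^2]. *)
    have k0 : 0 < Dstar ^+ 2 * m / c ^+ 2.
      by apply: divr_gt0; [exact: mulr_gt0|exact: exprn_gt0].
    have := ler_wpM2l (ltW k0) (bennett_bernstein (ltW cu0)).
    rewrite (_ : _ * (_ / _) = x ^+ 2 / (2 * (Dstar ^+ 2 * m + c * x / 3))); last first.
      have c3 : 3 + c * u != 0 by rewrite gt_eqF// addr_gt0.
      have m3 : Dstar ^+ 2 * m * 3 + c * (Dstar ^+ 2 * m * u) != 0.
        rewrite uE; apply/lt0r_neq0/addr_gt0; apply: mulr_gt0 => //; exact: mulr_gt0.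
      by rewrite -uE; field; rewrite ?c3 ?m3 ?Dn ?mn ?cn.
    rewrite (_ : _ * (_ - _) = Dstar ^+ 2 * m * psi_P_star c u)//.
    by rewrite /psi_P_star; field; rewrite ?cn.
  have -> : 2 * expR (- (Dstar ^+ 2 * m * psi_P_star c u)) =
      (expR (Dstar ^+ 2 * m * psi_P_star c u) / 2)^-1.
    by rewrite invf_div expRN.
  pose inc t w := increment Y t.+1 w.
  have mE t : borel_measurable (F t) (E t.+1) by have [] := hE t.+1 isT.
  have mU t : borel_measurable (F t) (fun w => kap * E t.+1 w).
    apply/borel_measurable_sigmaP => //; apply: measurable_funM => //.
    exact/borel_measurable_sigmaP.
  have iI t : P.-integrable setT (fun w => (`|inc t w| ^+ 2)%:E) by have [] := hE t.+1 isT.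
  have iE t : P.-integrable setT (fun w => (E t.+1 w)%:E) by have [] := hE t.+1 isT.
  have i1 A : measurable A -> P.-integrable A (EFin \o cst (1 : R)).
    by move=> mA; exact: finite_measure_integrable_cst.
  have iZ f : P.-integrable setT (fun w => (f w)%:E) -> forall A, measurable A ->
      P.-integrable A (fun w => (kap%:E * (f w)%:E)%E).
    move=> fi A mA; apply: integrableZl => //; exact: integrableS fi.
  have iD f : P.-integrable setT (fun w => (f w)%:E) -> forall A, measurable A ->
      P.-integrable A (fun w => (1 + kap * f w)%:E).
    move=> fi A mA; have := integrableD mA (i1 A mA) (iZ f fi A mA).
    by apply: eq_integrable => // w _ /=; rewrite EFinD EFinM.
  have ID f : P.-integrable setT (fun w => (f w)%:E) -> forall A, measurable A ->
      (\int[P]_(w in A) (1 + kap * f w)%:E = P A + kap%:E * \int[P]_(w in A) (f w)%:E)%E.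
    move=> fi A mA; have fA : P.-integrable A (fun w => (f w)%:E) by exact: integrableS fi.
    under eq_integral do rewrite EFinD EFinM.
    rewrite integralD//; [|exact: i1|exact: iZ].
    by rewrite integralZl// integral_cst// mul1e.
  apply: (@maximal_inequality _ _ _ P _ F Y Psi lam
    (fun t w => kap * V t w) (fun t w => kap * E t.+1 w)
    (fun t w => 1 + kap * `|inc t w| ^+ 2)
    X_separable F_filtration Y_martingale Y0 Psi0 lip' lam0) => //.
  + by move=> w; rewrite /V big_geq// mulr0.
  + by move=> t w; rewrite /V big_nat_recr//= mulrDr.
  + by move=> t; exact: iD.
  + move=> t A FA; have mA := FM _ _ FA.
    have [_ _ _ /(_ A FA) EI] := hE t.+1 isT.
    rewrite ID// -EI -ID//.
    (* A version of the conditional variance can be negative on a null set, so [1 + kap E] may have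
       either sign; its positive part is still below the exponential because [1 + s <= e^s]. *)
    apply: (@le_trans _ _ (\int[P]_(w in A) ((fun w => (1 + kap * E t.+1 w)%:E)^\+ w))%E).
      apply: le_integral => //; [exact: iD|apply: integrable_funepos => //; exact: iD|].
      by move=> w _; rewrite funeposE le_max lexx.
    apply: ge0_le_integral => //.
    * by apply: measurable_funepos; exact: measurable_int (iD _ (iE t) A mA).
    * apply: measurable_funTS; apply/measurable_EFinP; apply: measurableT_comp => //.
      by apply: borel_measurable_fun; apply: borel_measurable_subset (FM t) (mU t).
    * by move=> w _; rewrite funeposE ge_max !lee_fin expR_ge0 expR_ge1Dx.
  + move=> t y; have [L [Lb HL]] := coshR_smooth2_quadratic Psi_smooth y lam0 c0.
    by exists L; split => //; apply: filterS (hc t.+1 isT) => w Hw; exact: HL.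
  + by rewrite divr_gt0 ?expR_gt0.
  + move=> t; apply: measurable_funD => //; apply: measurable_funM => //.
    apply: measurable_funB => //; rewrite /V.
    under eq_fun do rewrite big_add1/=.
    apply: measurable_sum => i; apply: borel_measurable_fun.
    exact: borel_measurable_subset (FM i) (mE i).
  move=> t w H; rewrite mulrC divfK// ler_expR.
  have := ler_wpM2l lam0 H.
  (* [s_P] is the slope with [lam Dstar^2 s_P u = kap], so the terms in [V] cancel and
     [lam x - kap m] remains, which is the exponent of the bound. *)
  have -> : lam * (x + Dstar ^+ 2 * s_P c u * (V t w - m)) = lam * x + kap * (V t w - m).
    by rewrite kapE /s_P -/l /lam; field; rewrite ?Dn ?mn ?cn ?ln0.
  have -> : Dstar ^+ 2 * m * psi_P_star c u = lam * x - kap * m.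
    by rewrite kapE /psi_P_star -/l /lam -uE; field; rewrite ?Dn ?mn ?cn ?ln0.
  lra.
Qed.
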